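(* For all $n\geq 3$, there is a finite set $N_n\subset\mathbb{Q}$ such that, for all cyclotomic model sets $\Lambda$ with underlying $\mathbb{Z}$-module $\mathbb{Z}[\zeta_n]$ and all sets $U$ of four pairwise non-parallel $\mathbb{Z}[\zeta_n]$-directions, the following holds: if the cross ratio of slopes of the directions of $U$, arranged in order of increasing angle with the positive real axis, does not map under the norm $N_{\mathbb{Q}(\zeta_n+\bar{\zeta}_n)/\mathbb{Q}}$ to $N_n$ (i.e., its image under this norm is not an element of $N_n$), then the convex subsets of $\Lambda$ are determined by the $X$-rays in the directions of $U$.
   Context: Identify $\mathbb{R}^2$ with $\mathbb{C}$; $\zeta_n:=e^{2\pi i/n}$; $\phi$ is Euler's totient function. Cyclotomic model sets: let $n\ge 3$. A star map is any map $.^{\star}:\mathbb{Z}[\zeta_n]\to(\mathbb{R}^2)^{\phi(n)/2-1}$ of the form $z\mapsto(\sigma_2(z),\dots,\sigma_{\phi(n)/2}(z))$, where $\{\sigma_2,\dots,\sigma_{\phi(n)/2}\}$ arises from $\operatorname{Gal}(\mathbb{Q}(\zeta_n)/\mathbb{Q})\setminus\{\mathrm{id},\bar{\cdot}\}$ by choosing exactly one automorphism from each pair of complex conjugate ones. For $\phi(n)=2$ (i.e. $n\in\{3,4,6\}$), $(\mathbb{R}^2)^{\phi(n)/2-1}$ is the trivial group $\{0\}$ and the star map is the zero map. A cyclotomic model set with underlying $\mathbb{Z}$-module $\mathbb{Z}[\zeta_n]$ is any translate (in $\mathbb{R}^2$) of a set $\Lambda(W):=\{z\in\mathbb{Z}[\zeta_n]: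 z^{\star}\in W\}$, where $.^{\star}$ is such a star map and $W\subset(\mathbb{R}^2)^{\phi(n)/2-1}$ satisfies $\varnothing\ne\operatorname{int}W\subset W\subset\operatorname{cl}(\operatorname{int}W)$ with $\operatorname{cl}(\operatorname{int}W)$ compact. Directions are elements of the unit circle $\mathbb{S}^1$. For $S\subset\mathbb{R}^2$, an $S$-direction is a direction parallel to a non-zero element of $S-S$. For a finite set $F\subset\mathbb{R}^2$ and a direction $u$, the $X$-ray $X_uF$ is the function assigning to each line $\ell$ in direction $u$ the number $\operatorname{card}(F\cap\ell)$. The elements of a collection $\mathcal{E}$ of finite sets are determined by the $X$-rays in the directions of a finite set $U$ of directions if, for all $F,F'\in\mathcal{E}$, $X_uF=X_uF'$ for all $u\in U$ implies $F=F'$. A convex subset of $\Lambda\subset\mathbb{R}^2$ is a bounded subset $C\subset\Lambda$ with $C=\operatorname{conv}(C)\cap\Lambda$ (for cyclotomic model sets, which are uniformly discrete, such $C$ are finite). The cross ratio of four pairwise distinct $t_1,t_2,t_3,t_4\in\mathbb{R}\cup\{\infty\}$ is $\langle t_1,t_2,t_3,t_4\rangle:=\frac{(t_3-t_1)(t_4-t_2)}{(t_3-t_2)(t_4-t_1)}$, with the usual conventions if some $t_i=\infty$. The slope of a vertical direction is $\infty$. The angle of a direction $u$ with the positive real axis is the angle in $[0,\pi)$ of the line $\mathbb{R}u$. The cross ratio of slopes of four pairwise non-parallel $\mathbb{Z}[\zeta_n]$-directions lies in $\mathbb{Q}(\zeta_n+\bar\zeta_n)$, the maximal real subfield of $\mathbb{Q}(\zeta_n)$.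 *)

(* Defs.v *)
From HB Require Import structures.
From mathcomp Require Import all_boot all_order all_algebra all_fingroup all_field.
From mathcomp Require Import finmap complex.
From mathcomp Require Import all_classical all_reals all_analysis.
From mathcomp Require Import lra.

Set Implicit Arguments.
Unset Strict Implicit.
Unset Printing Implicit Defensive.

Import Order.TTheory GRing.Theory Num.Theory.
Import numFieldTopology.Exports.

Local Open Scope classical_set_scope.
Local Open Scope ring_scope.

(* The plane R^2 = C is R[i]. *)

Definition cis (R : realType) (t : R) : R[i] := (cos t +i* sin t)%C.

Definition zeta (R : realType) (n : nat) : R[i] := cis (2 * pi / n%:R).

(* Z[a] for an element a of a commutative ring *)
Definition Zadj (A : comNzRingType) (a : A) : set A :=
  [set x | exists p : {poly int}, x = (map_poly intr p).[a]].

(* A presentation of the number field Q(zeta_n) inside C: [cf_emb] identifies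
   the abstract field [cf_field] with the subfield Q(zeta_n) of C.
   See [cyclotomic_field_exists] below. *)
Record cyclotomic_field (R : realType) (n : nat) := CyclotomicField {
  cf_field :> splittingFieldType rat;
  cf_gen : cf_field;
  cf_emb : {rmorphism cf_field -> R[i]};
  cf_emb_gen : cf_emb cf_gen = zeta R n;
  cf_gen_full : <<1; cf_gen>>%VS = fullv
}.

Lemma cisD (R : realType) (s t : R) : cis (s + t) = cis s * cis t.
Proof. by rewrite /cis cosD sinD; simpc; rewrite [in LHS]addrC [X in (X +i* _)%C]addrC [X in (_ +i* X)%C]addrC. Qed.

Lemma cisX (R : realType) (t : R) k : cis t ^+ k = cis (t * k%:R).
Proof.
elim: k => [|k IH]; first by rewrite mulr0 expr0 /cis cos0 sin0.
by rewrite exprS IH -cisD -natr1 mulrDr mulr1 addrC.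
Qed.

Lemma zeta_prim_root (R : realType) n : (0 < n)%N -> n.-primitive_root (zeta R n).
Proof.
move=> n_gt0; have nR : 0 < (n%:R : R) by rewrite ltr0n.
rewrite /primitive_root_of_unity n_gt0; apply/forallP => -[i ltin]/=.
rewrite unity_rootE /zeta cisX; set m := i.+1.
have -> : 2 * pi / n%:R * m%:R = (pi * (m%:R / n%:R)) *+ 2 :> R.
  by rewrite -[RHS]mulr_natl mulrAC -!mulrA.
have [-> | neq_mn] := eqVneq m n.
  rewrite (divff (lt0r_neq0 nR)) mulr1 eqb_id /cis eq_complex /=.
  by rewrite -[pi *+ 2]add0r cosD2pi sinD2pi cos0 sin0 !eqxx.
rewrite eqbF_neg /cis eq_complex /= cos_mulr2n negb_and.
apply/orP; left; rewrite cos2sin2.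
have m_lt : (m < n)%N by rewrite ltn_neqAle neq_mn.
have : 0 < sin (pi * (m%:R / n%:R) : R).
  apply: sin_gt0_pi; rewrite mulr_gt0 ?pi_gt0 ?divr_gt0 ?ltr0n //=.
  by rewrite gtr_pMr ?pi_gt0 // ltr_pdivrMr // mul1r ltr_nat.
set s := sin _ => s_gt0; rewrite mulr2n; apply/eqP => h.
have : s ^+ 2 = 0 by lra.
by move/eqP; rewrite sqrf_eq0 gt_eqF.
Qed.

Lemma root_Cyclotomic (F : fieldType) n (z : F) :
  n.-primitive_root z -> root (map_poly intr (Cyclotomic n)) z.
Proof.
move=> prim_z; have n_gt0 := prim_order_gt0 prim_z.
have zr : (map_poly intr (\prod_(d <- divisors n) Cyclotomic d)).[z] = 0.
  rewrite (prod_Cyclotomic n_gt0) rmorphB rmorph1 /= map_polyXn.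
  by rewrite !hornerE (prim_expr_order prim_z) subrr.
have /eqP := zr; rewrite rmorph_prod /= horner_prod prodf_seq_eq0 => /hasP[d].
rewrite -dvdn_divisors //= => dn dr.
have d_gt0 : (0 < d)%N by exact: dvdn_gt0 dn.
suff -> : n = d by [].
apply/eqP; rewrite eqn_dvd dn andbT (prim_order_dvd prim_z).
rewrite -subr_eq0; apply/eqP.
have -> : z ^+ d - 1 = (map_poly intr ('X^d - 1)).[z].
  by rewrite rmorphB rmorph1 /= map_polyXn !hornerE.
rewrite -(prod_Cyclotomic d_gt0) rmorph_prod /= horner_prod.
rewrite (big_rem d) /= -?dvdn_divisors //.
by have /eqP -> := dr; rewrite mul0r.
Qed.

Lemma cyclotomic_field_exists (R : realType) n :
  (0 < n)%N -> inhabited (cyclotomic_field R n).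
Proof.
move=> n_gt0; have prim_z := zeta_prim_root R n_gt0.
pose iota : {rmorphism rat -> R[i]} := @ratr R[i].
pose p : {poly rat} := map_poly intr (Cyclotomic n).
have mp (F : numFieldType) : map_poly (ratr : rat -> F) p = map_poly intr (Cyclotomic n).
  by rewrite -map_poly_comp; apply: eq_map_poly => x /=; rewrite ratr_int.
have pz0 : root (map_poly iota p) (zeta R n) by rewrite mp; apply: root_Cyclotomic.
have irr_p : irreducible_poly p.
  have [w prim_w] := C_prim_root_exists n_gt0.
  have [q [Dq mon_q] dvq] := minCpolyP w.
  have Dp : p = q.
    apply: (map_poly_inj (ratr : {rmorphism rat -> algC})).
    by rewrite -Dq (minCpoly_cyclotomic prim_w) mp (Cintr_Cyclotomic prim_w).
  have wq : root (map_poly (ratr : rat -> algC) q) w by rewrite dvq.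
  apply/(@subfx_irreducibleP _ _ (ratr : {rmorphism rat -> algC}) w).
  - by rewrite Dp.
  - by rewrite Dp monic_neq0.
  by move=> r rw nz_r; rewrite Dp dvdp_leq // -dvq.
have nz_p : p != 0 by exact: irredp_neq0.
pose Q : fieldExtType rat := SubFieldExtType pz0 irr_p.
pose e : {rmorphism Q -> R[i]} := @subfx_inj _ _ iota (zeta R n) p.
pose w : Q := subfx_root iota (zeta R n) p.
have ew : e w = zeta R n by exact: subfx_inj_root.
have gen_w : <<1; w>>%VS = fullv.
  apply/eqP; rewrite eqEsubv subvf; apply/subvP => x _.
  have [q ->] := subfxEroot pz0 nz_p x.
  apply: rpred_horner; last exact: memv_adjoin.
  apply/polyOverP => i; rewrite coef_map; apply: subvP (subv_adjoin _ _) _ _.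
  exact: rpredZ (rpred1 _).
have prim_w : n.-primitive_root w by rewrite -(fmorph_primitive_root e) ew.
have Q_Xn1 : ('X^n - 1 : {poly Q}) \is a polyOver 1%AS.
  by rewrite rpredB ?rpred1 ?rpredX //= polyOverX.
have splitXn1 : splittingFieldFor 1 ('X^n - 1) {:Q}.
  pose r := codom (fun i : 'I_n => w ^+ i).
  have Dr : 'X^n - 1 = \prod_(y <- r) ('X - y%:P).
    by rewrite -(factor_Xn_sub_1 prim_w) big_mkord big_image.
  exists r; first by rewrite -Dr eqpxx.
  apply/eqP; rewrite eqEsubv subvf -gen_w -adjoin_seq1 adjoin_seqSr //.
  apply/allP => /=.
  by rewrite andbT -root_prod_XsubC -Dr rootE !hornerE (prim_expr_order prim_w) subrr.
have Q_ax : FieldExt_isSplittingField _ Q by constructor; exists ('X^n - 1).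
pose Qs : splittingFieldType rat := HB.pack_for (splittingFieldType rat) Q Q_ax.
by constructor; exact: (@CyclotomicField R n Qs w e ew gen_w).
Qed.

Section CyclotomicModelSets.
Variables (R : realType) (n : nat) (K : cyclotomic_field R n).

Definition conjugate_auts (s t : gal_of {:K}) : Prop :=
  forall x : K, cf_emb K (s x) = ((cf_emb K (t x))^*)%C.

Definition nontrivial_aut (s : gal_of {:K}) : Prop :=
  [/\ s \in 'Gal({:K} / 1)%g, s <> 1%g & ~ conjugate_auts s 1%g].

(* phi(n)/2 - 1, the number of factors R^2 of the internal space *)
Definition star_dim : nat := ((totient n)./2).-1.

(* (R^2)^(phi(n)/2 - 1) with the product topology *)
Local Notation internal_space := {ptws 'I_star_dim -> (R * R)%type}.

(* s enumerates, without repetition, a system of representatives of the pairs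
   of complex conjugate automorphisms other than {id, conjugation}. *)
Definition star_choice (s : 'I_star_dim -> gal_of {:K}) : Prop :=
  (forall i, nontrivial_aut (s i)) /\
  (forall t, nontrivial_aut t ->
     exists! i, s i = t \/ conjugate_auts (s i) t).

Definition star_map (s : 'I_star_dim -> gal_of {:K}) (x : K) : internal_space :=
  fun i => let z := cf_emb K (s i x) in (complex.Re z, complex.Im z).

Definition window (W : set internal_space) : Prop :=
  [/\ W° !=set0, W `<=` closure (W°) & compact (closure (W°))].

Definition cyclotomic_model_set (L : set R[i]) : Prop :=
  exists (s : 'I_star_dim -> gal_of {:K}) (W : set internal_space) (t : R[i]),
    [/\ star_choice s, window W &
        L = [set t + cf_emb K x | x in
               [set x | Zadj (cf_gen K) x /\ W (star_map s x)]]].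

(* Q(zeta_n + conj zeta_n); the conjugate of zeta_n is its inverse. *)
Definition max_real_subfield : {subfield K} :=
  <<1; cf_gen K + (cf_gen K)^-1>>%AS.

(* The real number x lies in Q(zeta_n + conj zeta_n) and its norm to Q is r. *)
Definition real_norm (x : R) (r : rat) : Prop :=
  exists q : K, [/\ q \in max_real_subfield, cf_emb K q = (x%:C)%C &
                    galNorm 1 max_real_subfield q = r%:A].

End CyclotomicModelSets.

Section DiscreteTomography.
Variable R : realType.
Implicit Types (u v : R[i]) (S E L C F : set R[i]).

Definition direction u : Prop := `|u| = 1.

Definition parallel (z w : R[i]) : Prop :=
  exists k : R, k != 0 /\ z = (k%:C)%C * w.

Definition set_direction S u : Prop :=
  direction u /\
  exists x y, [/\ S x, S y, x - y <> 0 & parallel (x - y) u].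

Definition lines u : set (set R[i]) :=
  [set l | exists x, l = [set x + (k%:C)%C * u | k in @setT R]].

(* Meaningful for finite F, as [fset_set] is empty on infinite sets. *)
Definition Xray F (l : set R[i]) : nat := #|` fset_set (F `&` l)|.

Definition same_Xray u F F' : Prop :=
  forall l, lines u l -> Xray F l = Xray F' l.

Definition determined_by_Xrays (E : set (set R[i])) (U : set R[i]) : Prop :=
  forall F F', E F -> E F' -> (forall u, U u -> same_Xray u F F') -> F = F'.

(* [Rcomplex R] is R[i] seen as a real vector space. *)
Definition convex_hull S : set R[i] := smallest (@convex_set R (Rcomplex R)) S.

Definition convex_subset L C : Prop :=
  [/\ exists M : R, forall z, C z -> `|z| <= (M%:C)%C,
      C `<=` L & C = convex_hull C `&` L].

(* R together with the point at infinity [None] *)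
Definition slope u : option R :=
  if complex.Re u == 0 then None else Some (complex.Im u / complex.Re u).

Definition cross_ratio (t1 t2 t3 t4 : option R) : R :=
  match t1, t2, t3, t4 with
  | Some a, Some b, Some c, Some d => ((c - a) * (d - b)) / ((c - b) * (d - a))
  | None, Some b, Some c, Some d => (d - b) / (c - b)
  | Some a, None, Some c, Some d => (c - a) / (d - a)
  | Some a, Some b, None, Some d => (d - b) / (d - a)
  | Some a, Some b, Some c, None => (c - a) / (c - b)
  | _, _, _, _ => 0 (* not pairwise distinct *)
  end.

(* the t in [0, pi) such that the line R u is R e^(it) *)
Definition line_angle u : R :=
  get [set t | 0 <= t < pi /\ parallel u (cis t)].

Definition by_angle (U : {fset R[i]}) : seq R[i] :=
  sort (fun u v => line_angle u <= line_angle v) U.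

Definition slopes_cross_ratio (U : {fset R[i]}) : R :=
  let t i := slope (by_angle U)`_i in
  cross_ratio (t 0%N) (t 1%N) (t 2%N) (t 3%N).

End DiscreteTomography.

(* Main.v *)
(* Suppose two different convex subsets F, F' have the same X-rays in the
   directions of U.  Colour the points of the symmetric difference by the set
   they belong to.  A point p lies outside the convex hull of the other colour,
   so some functional v_p is larger at p than at all points of the other colour;
   order the points cyclically by the angle of v_p.  For u in U, the lines in
   direction u link points of different colours, and a Cauchy-Binet identity
   shows that, up to moving inside runs of one colour, this linking is a
   reflection i -> c_u - i of the cyclic sequence of the N runs.  With w a
   primitive N-th root of unity and run(p) the run of p, the real-linear map
   m(u) = sum_p det(u, p - centroid) w^run(p) satisfies m(u) = w^c_u conj(m(u))
   for u in U and does not vanish there (Chebyshev's sum inequality), so it maps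
   U to directions of a regular N-gon.  Hence the cross ratio is
   (w3 - w1)(w4 - w2) / ((w3 - w2)(w4 - w1)) with N-th roots of unity w_i.
   For a root of unity x <> 1 some prime p has p / (1 - x)^(p-1) integral, so
   that the norm of this cross ratio has numerator and denominator at most 4^n,
   whatever N is. *)
Require Import Defs.
From HB Require Import structures.
From mathcomp Require Import all_boot all_order all_algebra all_fingroup all_field.
From mathcomp Require Import finmap complex.
From mathcomp Require Import all_classical all_reals all_analysis.
From mathcomp Require Import zify ring lra.

Set Implicit Arguments.
Unset Strict Implicit.
Unset Printing Implicit Defensive.

Import Order.TTheory GRing.Theory Num.Theory.

Local Open Scope classical_set_scope.
Local Open Scope ring_scope.

(** * Reflections of a two-coloured cycle *)

Section ColourChanges.
Variable C : nat -> bool.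

(** With runs numbered from index 0, this is the number of the run containing index [i]; over a full
    period of the cycle it is the number of runs. *)
Definition changes (i : nat) : nat := (\sum_(j < i) (C j != C j.+1))%N.

Lemma changesS i : changes i.+1 = (changes i + (C i != C i.+1))%N.
Proof. by rewrite /changes big_ord_recr. Qed.

Lemma changes0 : changes 0 = 0%N. Proof. by rewrite /changes big_ord0. Qed.

Lemma leq_changes i j : (i <= j)%N -> (changes i <= changes j)%N.
Proof.
move=> /subnKC <-; elim: (j - i)%N => [|k IH]; first by rewrite addn0.
by rewrite addnS changesS (leq_trans IH) ?leq_addr.
Qed.

Lemma odd_changes i : odd (changes i) = C 0%N (+) C i.
Proof.
elim: i => [|i IH]; first by rewrite changes0 addbb.
rewrite changesS oddD IH; by case: (C i) (C 0%N) (C i.+1) => [] [] [].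
Qed.

Lemma changes_eq_colour i j : changes i = changes j -> C i = C j.
Proof.
by move=> /(congr1 odd); rewrite !odd_changes; case: (C 0%N) (C i) (C j) => [] [] [].
Qed.

Lemma ltn_changes i j : (i <= j)%N -> C i != C j -> (changes i < changes j)%N.
Proof.
move=> lij; rewrite ltn_neqAle leq_changes // andbT; apply: contraNneq => h.
exact/eqP/changes_eq_colour.
Qed.

Lemma changes_last s i : (s <= i)%N -> (changes s < changes i)%N ->
  exists k, [/\ (s <= k < i)%N, C k != C i & changes i = (changes k).+1].
Proof.
move=> /subnKC <-; elim: (i - s)%N => [|d IH]; first by rewrite addn0 ltnn.
rewrite addnS changesS => lt.
have [eqC|neC] := eqVneq (C (s + d)%N) (C (s + d).+1); last first.
  by exists (s + d)%N; rewrite neC leq_addr ltnSn addn1.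
move: lt; rewrite eqC eqxx addn0 => /IH[k [/andP[k1 k2] k3 k4]].
by exists k; rewrite k1 -eqC k3 k4 ltnS ltnW.
Qed.

Lemma changes_next j e : (j <= e)%N -> (changes j < changes e)%N ->
  exists k, [/\ (j < k <= e)%N, C k != C j & changes k = (changes j).+1].
Proof.
move=> /subnKC <-; elim: (e - j)%N => [|d IH]; first by rewrite addn0 ltnn.
rewrite addnS => lt.
have [lt'|ge] := ltnP (changes j) (changes (j + d)).
  have [k [/andP[k1 k2] k3 k4]] := IH lt'.
  by exists k; rewrite k1 k3 k4 (leq_trans k2).
have eqj : changes (j + d) = changes j.
  by apply/eqP; rewrite eqn_leq ge leq_changes ?leq_addr.
exists (j + d).+1; move: lt; rewrite changesS eqj ltnS leq_addr leqnn.
rewrite (changes_eq_colour eqj); case: eqVneq; first by rewrite addn0 ltnn.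
by rewrite addn1.
Qed.

Variable M : nat.
Hypothesis perC : forall i, C (i + M)%N = C i.

Lemma changes_period i : changes (i + M) = (changes i + changes M)%N.
Proof.
elim: i => [|i IH]; first by rewrite add0n changes0.
by rewrite addSn !changesS IH -addSn !perC addnAC.
Qed.

Lemma changes_periodM i k : changes (i + k * M) = (changes i + k * changes M)%N.
Proof.
elim: k => [|k IH]; first by rewrite !mul0n !addn0.
by rewrite !mulSn addnCA addnC changes_period IH; ring.
Qed.

(* A reflection of the cycle: along [s, e) the height x increases and along
   [e, s + M) it decreases, as far as indices of different colours can tell. *)
Record reflecting (R : realType) (x : nat -> R) (s e : nat) : Prop := Reflecting {
  refl_se : (s < e)%N;
  refl_et : (e < s + M)%N;
  refl_up : forall i j, (s <= i)%N -> (i < j < e)%N -> C i != C j -> x i < x j;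
  refl_down : forall i j, (e <= i)%N -> (i < j < s + M)%N -> C i != C j -> x j < x i;
  refl_link1 : forall i, (s <= i < e)%N -> exists2 j, (e <= j < s + M)%N & x j = x i;
  refl_link2 : forall j, (e <= j < s + M)%N -> exists2 i, (s <= i < e)%N & x i = x j;
  refl_opp : forall i j, (s <= i < e)%N -> (e <= j < s + M)%N -> x i = x j -> C i != C j
}.

Variables (R : realType) (x : nat -> R) (s e : nat).
Hypothesis H : reflecting x s e.
Let lt_se := refl_se H.
Let lt_et := refl_et H.
Let x_up := refl_up H.
Let x_down := refl_down H.
Let x_link1 := refl_link1 H.
Let x_link2 := refl_link2 H.
Let x_opp := refl_opp H.

(** The sum of the run numbers at the first index of the rising half and the last index of the
    falling half; every linked pair turns out to have this sum. *)
Let c := (changes s + changes (s + M).-1)%N.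

(** Heights may oscillate inside a run but not across runs: indices of one colour in different runs
    are compared through an index of the other colour between them. *)
Lemma changes_up_le i i' : (s <= i < e)%N -> (s <= i' < e)%N -> x i < x i' ->
  (changes i <= changes i')%N.
Proof.
move=> /andP[si ie] /andP[si' ie'] xx; rewrite leqNgt; apply/negP => lt.
have lti : (i' < i)%N by rewrite ltnNge; apply/negP => /leq_changes; rewrite leqNgt lt.
have [ne|eqC] := boolP (C i' != C i).
  by have := x_up si' _ ne; rewrite lti ie => /(_ isT); rewrite ltNge (ltW xx).
have [k [/andP[k1 k2] k3 k4]] := changes_last (ltnW lti) lt.
move: eqC; rewrite negbK => /eqP eqC.
have ltk : (i' < k)%N by rewrite ltn_neqAle k1 andbT; apply: contraNneq k3 => <-; rewrite eqC.
have h1 : x i' < x k by apply: x_up => //; rewrite ?ltk ?(ltn_trans k2) // eqC eq_sym.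
have h2 : x k < x i by apply: x_up => //; rewrite ?k2 ?(leq_trans si').
by have := lt_trans xx (lt_trans h1 h2); rewrite ltxx.
Qed.

(** Induction on [i], one run at a time: an index [k] of the preceding run is lower than [i], so its
    partner [l] comes after [j], in a later run. In the first run the bound is immediate from
    [c]. *)
Lemma reflect_leq i j : (s <= i < e)%N -> (e <= j < s + M)%N -> x i = x j ->
  (changes i + changes j <= c)%N.
Proof.
elim/ltn_ind: i j => i IH j /andP[si ie] /andP[ej jt] xij.
have [lt|le] := ltnP (changes s) (changes i); last first.
  apply: leq_add => //; apply: leq_changes; lia.
have [k [/andP[k1 k2] k3 k4]] := changes_last si lt.
have kI : (s <= k < e)%N by lia.
have [l lJ xl] := x_link1 kI.
have xki : x k < x i by apply: x_up => //; rewrite k2.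
have := IH k k2 l kI lJ (esym xl).
have lC := x_opp kI lJ (esym xl).
have jC : C i != C j by apply: x_opp => //; apply/andP.
have ljC : C l != C j by move: lC jC k3; case: (C k) (C i) (C j) (C l) => [] [] [] [].
have ltjl : (j < l)%N.
  rewrite ltnNge leq_eqVlt; apply/negP => /orP[/eqP E|lt'].
    by move: ljC; rewrite E eqxx.
  have : x j < x l by apply: x_down => //; [lia | rewrite lt'].
  by rewrite xl -xij ltNge (ltW xki).
have := ltn_changes (ltnW ltjl); rewrite eq_sym => /(_ ljC); lia.
Qed.

(** The mirror argument, by induction on the distance from [j] to the end of the period: an index of
    the run after that of [j] has its partner in an earlier run than [i]. *)
Lemma reflect_geq i j : (s <= i < e)%N -> (e <= j < s + M)%N -> x i = x j ->
  (c <= changes i + changes j)%N.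
Proof.
move Dd : ((s + M) - j)%N => d.
elim/ltn_ind: d i j Dd => d IH i j Dd /andP[si ie] /andP[ej jt] xij.
have [lt|le] := ltnP (changes j) (changes (s + M).-1); last first.
  by apply: leq_add => //; apply: leq_changes.
have jt' : (j <= (s + M).-1)%N by lia.
have [k [/andP[k1 k2] k3 k4]] := changes_next jt' lt.
have kI : (e <= k < s + M)%N by lia.
have [l lJ xl] := x_link2 kI.
have xki : x k < x j by apply: x_down => //; [lia | rewrite eq_sym].
have dk : (s + M - k < d)%N by lia.
have := IH _ dk l k erefl lJ kI xl.
have lC := x_opp lJ kI xl.
have jC : C i != C j by apply: x_opp => //; apply/andP.
have ljC : C l != C i by move: lC jC k3; case: (C k) (C i) (C j) (C l) => [] [] [] [].
have ltjl : (l < i)%N.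
  rewrite ltnNge leq_eqVlt; apply/negP => /orP[/eqP E|lt'].
    by move: ljC; rewrite E eqxx.
  have : x i < x l by apply: x_up => //; [lia | rewrite eq_sym].
  by rewrite xl xij ltNge (ltW xki).
have := ltn_changes (ltnW ltjl) ljC; lia.
Qed.

Lemma reflect_changes i j : (s <= i < e)%N -> (e <= j < s + M)%N -> x i = x j ->
  (changes i + changes j)%N = c.
Proof. by move=> *; apply/eqP; rewrite eqn_leq reflect_leq // reflect_geq. Qed.

(** The index [s] is linked to an index in the run of [(s + M).-1], and linked indices differ in
    colour. *)
Lemma changes_cut_start : changes (s + M) = (changes (s + M).-1).+1.
Proof.
have sI : (s <= s < e)%N by rewrite leqnn.
have [j jJ xj] := x_link1 sI.
have /addnI/changes_eq_colour Cj := reflect_changes sI jJ (esym xj).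
have := x_opp sI jJ (esym xj).
have -> : (s + M)%N = (s + M).-1.+1 by lia.
rewrite changesS -Cj.
have -> : (s + M).-1.+1 = (s + M)%N by lia.
by rewrite perC eq_sym => ->; rewrite addn1.
Qed.

(** The links of [e] and of [e.-1] have the same run sum, which forces the partner of [e] into the
    run of [e.-1]; its colour differs from that of [e]. *)
Lemma changes_cut_end : changes e = (changes e.-1).+1.
Proof.
have eJ : (e <= e < s + M)%N by rewrite leqnn.
have eI : (s <= e.-1 < e)%N by lia.
have [i iI xi] := x_link2 eJ; have [j jJ xj] := x_link1 eI.
have h1 := reflect_changes iI eJ xi.
have h2 := reflect_changes eI jJ (esym xj).
have h3 : (changes i <= changes e.-1)%N by apply: leq_changes; lia.
have h4 : (changes e <= changes j)%N by apply: leq_changes; lia.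
have /changes_eq_colour Ci : changes i = changes e.-1 by lia.
have := x_opp iI eJ xi.
have De : e.-1.+1 = e by lia.
have -> : changes e = changes e.-1.+1 by rewrite De.
by rewrite changesS De Ci => ->; rewrite addn1.
Qed.

(** The reflection exchanges the runs of the two halves, so each half has
    [changes e.-1 - changes s + 1] of them. *)
Lemma reflect_total : changes M = (2 * (changes e.-1 - changes s)).+2.
Proof.
have eI : (s <= e.-1 < e)%N by lia.
have eJ : (e <= e < s + M)%N by rewrite leqnn.
have [i iI xi] := x_link2 eJ; have [j jJ xj] := x_link1 eI.
have h1 := reflect_changes iI eJ xi.
have h2 := reflect_changes eI jJ (esym xj).
have h3 : (changes i <= changes e.-1)%N by apply: leq_changes; lia.
have h4 : (changes e <= changes j)%N by apply: leq_changes; lia.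
have h5 := changes_cut_start; have h6 := changes_cut_end.
have h7 := changes_period s.
have h8 : (changes s <= changes e.-1)%N by apply: leq_changes; lia.
rewrite /c in h1 h2; lia.
Qed.

(** The odd sum places the axis of the reflection between the last run of the rising half and the
    first run of the falling half. *)
Lemma reflect_sum i j : (s <= i < e)%N -> (e <= j < s + M)%N -> x i = x j ->
  (changes i + changes j)%N = (2 * changes e.-1).+1.
Proof.
move=> iI jJ xij; rewrite (reflect_changes iI jJ xij) /c.
have h5 := changes_cut_start; have h7 := changes_period s; have h9 := reflect_total.
have h8 : (changes s <= changes e.-1)%N by apply: leq_changes; lia.
lia.
Qed.

(** The halves occupy disjoint blocks of run numbers inside one interval of length [changes M]. *)
Lemma halves_changes_neq i j : (s <= i < e)%N -> (e <= j < s + M)%N ->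
  changes i != changes j %[mod changes M].
Proof.
move=> /andP[si ie] /andP[ej jt].
have h5 := changes_cut_start; have h6 := changes_cut_end; have h7 := changes_period s.
have a1 : (changes s <= changes i)%N by apply: leq_changes.
have a2 : (changes i <= changes e.-1)%N by apply: leq_changes; lia.
have a3 : (changes e <= changes j)%N by apply: leq_changes.
have a4 : (changes j <= changes (s + M).-1)%N by apply: leq_changes; lia.
rewrite eq_sym eqn_mod_dvd; last lia.
by rewrite gtnNdvd; lia.
Qed.

End ColourChanges.

(** * Points in the plane in cyclic order *)

Section Plane.
Variable R : realType.
Implicit Types u v w d z : R[i].
Local Notation Re := complex.Re.
Local Notation Im := complex.Im.

Definition dotc u v : R := Re u * Re v + Im u * Im v.
Definition detc u v : R := Re u * Im v - Im u * Re v.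

(** The Binet-Cauchy identity in the plane. It turns the separation of two points by their
    functionals [v] and [w] into the sign of their height difference [detc u d]. *)
Lemma dotc_detc d u v w :
  dotc u v * dotc d w - dotc u w * dotc d v = detc u d * detc v w.
Proof. by rewrite /dotc /detc; ring. Qed.

Lemma detc_gt0 d u v w : 0 < dotc u v -> 0 < dotc u w -> dotc d v < 0 -> 0 < dotc d w ->
  0 <= detc v w -> 0 < detc u d.
Proof.
move=> h1 h2 h3 h4 h5.
have : 0 < detc u d * detc v w by rewrite -dotc_detc; nra.
by rewrite ltNge => h; rewrite ltNge; apply: contra h => h; nra.
Qed.

Lemma detc_lt0 d u v w : dotc u v < 0 -> dotc u w < 0 -> dotc d v < 0 -> 0 < dotc d w ->
  0 <= detc v w -> detc u d < 0.
Proof.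
move=> h1 h2 h3 h4 h5.
have : detc u d * detc v w < 0 by rewrite -dotc_detc; nra.
by rewrite ltNge => h; rewrite ltNge; apply: contra h => h; nra.
Qed.

Lemma detcBr u v w : detc u (v - w) = detc u v - detc u w.
Proof. by case: u v w => a b [c d] [e f]; rewrite /detc /=; ring. Qed.

Lemma detcDr u v w : detc u (v + w) = detc u v + detc u w.
Proof. by case: u v w => a b [c d] [e f]; rewrite /detc /=; ring. Qed.

Lemma detcZr u (k : R) : detc u (k%:C%C * u) = 0.
Proof. by case: u => a b; rewrite /detc /=; ring. Qed.

Lemma dotcZr u v (k : R) : dotc (k%:C%C * u) v = k * dotc u v.
Proof. by case: u v => a b [c d]; rewrite /dotc /=; ring. Qed.

Lemma dotc_gt0 u : u != 0 -> 0 < dotc u u.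
Proof.
case: u => a b; rewrite /dotc /= eq_complex /= negb_and -!expr2.
by case/orP => h; [apply: ltr_pwDl|apply: ltr_wpDl]; rewrite ?sqr_ge0 // lt_def sqr_ge0 expf_neq0.
Qed.

Lemma detc_eq0P u v : u != 0 -> detc u v = 0 -> v = (dotc u v / dotc u u)%:C%C * u.
Proof.
move=> /dotc_gt0 u0 h; apply/eqP; move: u0 h.
case: u v => a b [c d]; rewrite /detc /dotc /= eq_complex /= => u0 h.
have n0 := lt0r_neq0 u0.
rewrite !mul0r subr0 addr0.
apply/andP; split; apply/eqP/(mulfI n0)/eqP; rewrite -subr_eq0.
  have -> : (a * a + b * b) * c - (a * a + b * b) * ((a * c + b * d) / (a * a + b * b) * a) = - b * (a * d - b * c) by field.
  by rewrite h mulr0.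
have -> : (a * a + b * b) * d - (a * a + b * b) * ((a * c + b * d) / (a * a + b * b) * b) = a * (a * d - b * c) by field.
by rewrite h mulr0.
Qed.


Lemma polarP z : z != 0 ->
  exists2 r : R, 0 < r & exists2 t : R, 0 <= t < 2 * pi & Re z = r * cos t /\ Im z = r * sin t.
Proof.
move=> z0; have zz := dotc_gt0 z0.
pose r := Num.sqrt (dotc z z).
have r0 : 0 < r by rewrite sqrtr_gt0.
have rr : r ^+ 2 = Re z ^+ 2 + Im z ^+ 2 by rewrite sqr_sqrtr ?ltW // /dotc !expr2.
have rn := lt0r_neq0 r0.
pose a := Re z / r; pose b := Im z / r.
have ab : a ^+ 2 + b ^+ 2 = 1.
  by rewrite !expr_div_n -mulrDl -rr divff // expf_neq0.
have a1 : -1 <= a <= 1.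
  by rewrite -ler_norml -(ler_pXn2r (n:=2)) ?nnegrE // expr1n real_normK ?num_real //; nra.
have ca : cos (acos a) = a by rewrite acosK // in_itv /= ?itv_boundlr.
have sa : sin (acos a) = `|b|.
  by rewrite sin_acos // -sqrtr_sqr; congr Num.sqrt; lra.
have za : Re z = r * a by rewrite mulrC divfK.
have zb : Im z = r * b by rewrite mulrC divfK.
have p0 := pi_gt0 R; have h0 := acos_ge0 a1; have h1 := acos_lepi a1.
exists r => //.
have [bp|bn] := leP 0 b.
  exists (acos a); first by rewrite h0 /=; lra.
  by rewrite ca sa ger0_norm.
exists (2 * pi - acos a).
  have : acos a != 0.
    by apply: contraTneq bn => e; move: sa; rewrite e sin0 => /esym/normr0P/eqP ->; rewrite ltxx.
  by move=> ha; have : 0 < acos a; [rewrite lt_def ha|move=> ?; apply/andP; split; lra].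
rewrite cosB sinB !mulr_natl cos2pi sin2pi ca sa ltr0_norm // za zb; split; congr (r * _); ring.
Qed.

End Plane.

(* The cycle is unrolled over nat: cyc_point has period #|T|, and cyc_arg lifts
   the angle so that it increases along the indices. *)
Section CyclicOrder.
Variables (R : realType) (T : finType) (col : T -> bool) (arg : T -> R).
Hypothesis arg_itv : forall p, 0 <= arg p < 2 * pi.
Variable p0 : T.

Let L := sort (fun p q => arg p <= arg q) (enum T).
Let M := #|T|.

Definition cyc_point i := nth p0 L (i %% M).
Definition cyc_arg i := arg (cyc_point i) + 2 * pi * (i %/ M)%:R.
Definition cyc_col i := col (cyc_point i).
Local Notation P := cyc_point.
Local Notation ang := cyc_arg.

Let M_gt0 : (0 < M)%N. Proof. by apply/card_gt0P; exists p0. Qed.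
Let sizeL : size L = M. Proof. by rewrite size_sort -cardE. Qed.

Lemma cyc_colD i : cyc_col (i + M)%N = cyc_col i.
Proof. by rewrite /cyc_col /cyc_point modnDr. Qed.

Lemma cyc_argD i : ang (i + M)%N = ang i + 2 * pi.
Proof.
by rewrite /cyc_arg /cyc_point modnDr divnDr ?dvdnn // divnn M_gt0 natrD /=; ring.
Qed.

Lemma cis_cyc_arg i : cis (ang i) = cis (arg (P i)).
Proof.
rewrite /cyc_arg; elim: (i %/ M)%N => [|k IH]; first by rewrite mulr0 addr0.
rewrite -IH -[k.+1%:R]natr1 mulrDr mulr1 addrA /cis.
by rewrite [2 * pi]mulr_natl cosD2pi sinD2pi.
Qed.

Lemma leq_cyc_arg i j : (i <= j)%N -> ang i <= ang j.
Proof.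
move=> lij; rewrite /cyc_arg.
have p0R := pi_gt0 R.
have [lt|ge] := ltnP (i %/ M) (j %/ M).
  have /andP[_ h1] := arg_itv (P i); have /andP[h2 _] := arg_itv (P j).
  have : (i %/ M)%:R + 1 <= (j %/ M)%:R :> R by rewrite natr1 ler_nat.
  by move=> h3; have : 2 * pi * ((i %/ M)%:R + 1) <= 2 * pi * (j %/ M)%:R :> R;
    [rewrite ler_pM2l // mulr_gt0 // ltr0n|lra].
have e : (i %/ M = j %/ M)%N by apply/eqP; rewrite eqn_leq ge leq_div2r.
rewrite e lerD2r.
apply: (@sorted_leq_nth _ (fun p q => arg p <= arg q)).
- by move=> a b c; apply: le_trans.
- by move=> a; apply: lexx.
- by apply: sort_sorted => a b; apply: le_total.
- by rewrite inE sizeL ltn_pmod.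
- by rewrite inE sizeL ltn_pmod.
- by rewrite -(leq_add2l (i %/ M * M)) -divn_eq {1}e -divn_eq.
Qed.

Lemma cyc_cut (t : R) : exists k, forall i, (i < k)%N = (ang i <= t).
Proof.
have ex : exists k, t < ang k.
  (* Each period adds [2 * pi], so this index has an angle above [t]. *)
  exists (Num.Def.archi_bound (`|t|) * M)%N.
  rewrite /cyc_arg mulnK //; have /andP[h1 _] := arg_itv (P (Num.Def.archi_bound (`|t|) * M)).
  have h2 := archi_boundP (normr_ge0 t); have h3 := ler_norm t.
  have p1 : 2 <= pi :> R by apply: pi_ge2.
  have h4 := normr_ge0 t; nra.
have [k hk mink] := ex_minnP ex; exists k => i.
apply/idP/idP => [lt|le].
  by rewrite leNgt; apply: contraL lt => /mink; rewrite -leqNgt.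
by rewrite ltnNge; apply: contraL le => /leq_cyc_arg/(lt_le_trans hk); rewrite ltNge.
Qed.

Lemma cyc_surj s p : exists2 k, (s <= k < s + M)%N & P k = p.
Proof.
have pL : p \in L by rewrite mem_sort mem_enum.
have iM : (index p L < M)%N by rewrite -sizeL index_mem.
have Pk k : k = index p L %[mod M] -> P k = p.
  by rewrite /cyc_point => ->; rewrite modn_small // nth_index.
(* The largest index up to [s + M] in the residue class; if it is [s + M] itself, [s] serves
   instead. *)
pose k := (index p L + (s + M - index p L) %/ M * M)%N.
have kM : k = index p L %[mod M] by rewrite /k addnC modnMDl.
have := divn_eq (s + M - index p L) M.
have := ltn_pmod (s + M - index p L) M_gt0.
move=> h1 h2.
have : (s < k <= s + M)%N by rewrite /k; lia.
move=> /andP[h3 h4]; have [e|ne] := eqVneq k (s + M)%N; last first.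
  by exists k; [lia|apply: Pk].
by exists s; [lia|apply: Pk; rewrite -kM e modnDr].
Qed.

Definition cyc_index p := index p L.

Lemma cyc_indexK i : cyc_index (P i) = (i %% M)%N.
Proof.
by rewrite /cyc_index /cyc_point index_uniq ?sizeL ?ltn_pmod // sort_uniq enum_uniq.
Qed.

End CyclicOrder.

(** * Cutting the cycle into a rising and a falling half *)

Section Halves.
Local Notation Re := complex.Re.
Local Notation Im := complex.Im.
Variables (R : realType) (T : finType) (pt : T -> R[i]) (col : T -> bool) (arg : T -> R).
Hypothesis arg_itv : forall p, 0 <= arg p < 2 * pi.
Hypothesis arg_sep : forall p q, col p != col q -> 0 < dotc (pt p - pt q) (cis (arg p)).
Variable p0 : T.

Local Notation M := #|T|.
Local Notation P := (cyc_point arg p0).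
Local Notation ang := (cyc_arg arg p0).
Local Notation C := (cyc_col col arg p0).

Definition linked (u : R[i]) :=
  forall p, exists2 q, col q != col p & detc u (pt q) = detc u (pt p).

Variable u : R[i].
Hypotheses (u0 : u != 0) (lku : linked u).
Local Notation dir p := (dotc u (cis (arg p))).

(** The difference of the points is [k * u] for a real [k]. Separation at [p] makes [k * dir p]
    positive, separation at [q] makes [k * dir q] negative. *)
Lemma link_opposite p q : col p != col q -> detc u (pt p) = detc u (pt q) ->
  (0 < dir p /\ dir q < 0) \/ (dir p < 0 /\ 0 < dir q).
Proof.
move=> ne e; have ne' : col q != col p by rewrite eq_sym.
have h : detc u (pt p - pt q) = 0 by rewrite detcBr e subrr.
have := arg_sep ne; have := arg_sep ne'.
rewrite -opprB (detc_eq0P u0 h); set k := _ / _.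
have -> : - (k%:C%C * u) = (- k)%:C%C * u by rewrite rmorphN mulNr.
rewrite !dotcZr => h1 h2.
have [k0|k0|k0] := ltgtP k 0; last by move: h2; rewrite k0 mul0r ltxx.
  by right; split; nra.
by left; split; nra.
Qed.

(** If the colours agreed, a partner [r] of [p] would be linked to [q] as well and would have to lie
    opposite to both. *)
Lemma same_side_colour p q : detc u (pt p) = detc u (pt q) -> 0 < dir p -> dir q < 0 -> col p != col q.
Proof.
move=> e hp hq; apply/negP => /eqP ce.
have [r nr er] := lku p.
have h1 : 0 < dir r.
  by case: (@link_opposite r q) => [||[]|[]] //; rewrite ?er // -?ce //; move: hq; lra.
by case: (@link_opposite r p) => [||[]|[]] //; move: hp h1; lra.
Qed.

Lemma dotc_cis : exists2 r, 0 < r & exists2 b, 0 <= b < 2 * pi &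
  forall x : R, dotc u (cis x) = r * sin (x - b).
Proof.
(* The angle [b] is that of [u] turned clockwise by a quarter turn, so the sign changes at [b] and
   [b + pi]. *)
have z0 : (Im u +i* - Re u)%C != 0 :> R[i].
  by case: u u0 => a b; rewrite !eq_complex /= oppr_eq0 andbC.
have [r r0 [b b0 /= [h1 h2]]] := polarP z0.
exists r => //; exists b => // x.
rewrite sinB mulrBr /dotc /cis /=.
have -> : Re u = - (r * sin b) by rewrite -h2 opprK.
by rewrite h1; ring.
Qed.

(** Cutting the cyclic order at the angles [b], [b + pi] and [b + 2 * pi] sorts the points by the
    sign of [dir], which is never 0 because every point has a partner. *)
Lemma halves : exists s e,
  [/\ reflecting C M (fun i => detc u (pt (P i))) s e,
     forall i, (s <= i < e)%N -> 0 < dotc u (cis (arg (P i))) &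
     forall i, (e <= i < s + M)%N -> dotc u (cis (arg (P i))) < 0].
Proof.
have [r r0 [b /andP[b0 b1] dE]] := dotc_cis.
have [s hs] := cyc_cut arg_itv p0 b; have [e he] := cyc_cut arg_itv p0 (b + pi).
have pi0 := pi_gt0 R.
have ht i : (i < s + M)%N = (ang i <= b + 2 * pi).
  have [iM|Mi] := ltnP i M.
    rewrite (leq_trans iM) ?leq_addl //; apply/esym.
    rewrite /cyc_arg divn_small // mulr0 addr0.
    by have /andP[_ h] := arg_itv (P i); lra.
  rewrite -(subnK Mi) ltn_add2r hs cyc_argD //; apply/idP/idP; lra.
have dn p : dir p != 0.
  have [q /[!(eq_sym (col q))] cq eq] := lku p.
  by case: (link_opposite cq (esym eq)) => -[] => [/lt0r_neq0|/ltr0_neq0].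
have top i : (s <= i < e)%N -> 0 < dir (P i).
  move=> /andP[si ie]; rewrite lt_def dn -cis_cyc_arg dE mulr_ge0 ?(ltW r0) //.
  move: si ie; rewrite leqNgt hs he -ltNge => h1 h2.
  by apply: sin_ge0_pi; apply/andP; split; lra.
have bot i : (e <= i < s + M)%N -> dir (P i) < 0.
  move=> /andP[si ie]; rewrite lt_neqAle dn -cis_cyc_arg dE /=.
  move: si ie; rewrite leqNgt ht he -ltNge => h1 h2.
  have : 0 <= sin (ang i - b - pi) by apply: sin_ge0_pi; apply/andP; split; lra.
  rewrite [sin (_ - pi)]sinB cospi sinpi; nra.
have lse : (s <= e)%N.
  by rewrite leqNgt; apply/negP => h; have := h; rewrite hs => h'; have := he e; rewrite ltnn; lra.
have let' : (e <= s + M)%N.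
  rewrite leqNgt; apply/negP => h; have := h; rewrite he => h'; have := ht (s + M)%N; rewrite ltnn; lra.
have find p : exists2 k, (s <= k < s + M)%N & P k = p by exact: cyc_surj.
have find_top p : 0 < dir p -> exists2 k, (s <= k < e)%N & P k = p.
  move=> hp; have [k /andP[k1 k2] Pk] := find p; exists k => //.
  rewrite k1 ltnNge; apply/negP => k3.
  by have := bot k; rewrite k3 k2 Pk => /(_ isT); move: hp; lra.
have find_bot p : dir p < 0 -> exists2 k, (e <= k < s + M)%N & P k = p.
  move=> hp; have [k /andP[k1 k2] Pk] := find p; exists k => //.
  rewrite k2 andbT leqNgt; apply/negP => k3.
  by have := top k; rewrite k3 k1 Pk => /(_ isT); move: hp; lra.
have lk1 i : (s <= i < e)%N -> exists2 j, (e <= j < s + M)%N & detc u (pt (P j)) = detc u (pt (P i)).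
  move=> iI; have [q cq eq] := lku (P i).
  case: (link_opposite cq eq) => -[h1 h2]; first by move: (top _ iI); lra.
  by have [j jJ Pj] := find_bot q h1; exists j; rewrite ?Pj.
have lk2 i : (e <= i < s + M)%N -> exists2 j, (s <= j < e)%N & detc u (pt (P j)) = detc u (pt (P i)).
  move=> iI; have [q cq eq] := lku (P i).
  case: (link_opposite cq eq) => -[h1 h2]; last by move: (bot _ iI); lra.
  by have [j jJ Pj] := find_top q h1; exists j; rewrite ?Pj.
have detE i j : detc (cis (ang i)) (cis (ang j)) = sin (ang j - ang i).
  by rewrite sinB /detc /cis /=; ring.
have sep1 i j : C i != C j -> 0 < dotc (pt (P j) - pt (P i)) (cis (ang j)).
  by rewrite cis_cyc_arg eq_sym; apply: arg_sep.
have sep2 i j : C i != C j -> dotc (pt (P j) - pt (P i)) (cis (ang i)) < 0.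
  rewrite cis_cyc_arg => /arg_sep h; rewrite -oppr_gt0.
  by apply: (lt_le_trans h); rewrite -(opprB (pt (P j))) /dotc /= !raddfN; lra.
have M0 : (0 < M)%N by apply/card_gt0P; exists p0.
have hI i j : (i < j)%N -> 0 <= ang j - ang i by move=> /ltnW/(leq_cyc_arg arg_itv p0); lra.
exists s, e; split => //; split => //.
- have [k /andP[k1 k2] Pk] := find p0.
  have [lt|le] := ltnP k e; first exact: leq_ltn_trans lt.
  by have [|j /andP[j1 j2] _] := lk2 k; [apply/andP|exact: leq_ltn_trans j2].
- have [k /andP[k1 k2] Pk] := find p0.
  have [lt|le] := ltnP k e; last exact: leq_ltn_trans k2.
  by have [|j /andP[j1 j2] _] := lk1 k; [apply/andP|exact: leq_ltn_trans j2].
(* Angles within a half differ by less than [pi], so the Binet-Cauchy identity fixes the sign of the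
   height difference. *)
- move=> i j si /andP[ij je] ne.
  rewrite -subr_gt0 -detcBr.
  have h1 : 0 < dotc u (cis (ang i)) by rewrite cis_cyc_arg; apply: top; rewrite si (ltn_trans ij).
  have h2 : 0 < dotc u (cis (ang j)) by rewrite cis_cyc_arg; apply: top; rewrite je (leq_trans si) // ltnW.
  apply: (detc_gt0 h1 h2 (sep2 _ _ ne) (sep1 _ _ ne)); rewrite detE.
  have := hI _ _ ij; move: si je; rewrite leqNgt hs he -ltNge => h5 h6 h7.
  by apply: sin_ge0_pi; apply/andP; split; lra.
- move=> i j si /andP[ij je] ne.
  rewrite -subr_lt0 -detcBr.
  have h1 : dotc u (cis (ang i)) < 0 by rewrite cis_cyc_arg; apply: bot; rewrite si (ltn_trans ij).
  have h2 : dotc u (cis (ang j)) < 0 by rewrite cis_cyc_arg; apply: bot; rewrite je (leq_trans si) // ltnW.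
  apply: (detc_lt0 h1 h2 (sep2 _ _ ne) (sep1 _ _ ne)); rewrite detE.
  have := hI _ _ ij; move: si je; rewrite leqNgt he ht -ltNge => h5 h6 h7.
  by apply: sin_ge0_pi; apply/andP; split; lra.
- by move=> i j /top hi /bot hj e'; apply: same_side_colour.
Qed.

End Halves.

(** * The linear map onto directions of a regular polygon *)

(** Double counting: each term is spread evenly over the equally many points of the other kind in
    its fibre. *)
Lemma sum_matched_fibres (V : numFieldType) (S : eqType) (T : finType) (A B : pred T) (x : T -> S) (G G' : T -> V) :
  (forall y, #|[pred p | A p & x p == y]| = #|[pred p | B p & x p == y]|) ->
  (forall p q, A p -> B q -> x p = x q -> G p = G' q) ->
  \sum_(p | A p) G p = \sum_(q | B q) G' q.
Proof.
move=> cardE GE; pose n y : V := #|[pred p | A p & x p == y]|%:R.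
have n0 p : A p -> n (x p) != 0.
  by move=> Ap; rewrite pnatr_eq0 -lt0n; apply/card_gt0P; exists p; rewrite inE Ap /=.
have n1 p : B p -> n (x p) != 0.
  by move=> Ap; rewrite /n cardE pnatr_eq0 -lt0n; apply/card_gt0P; exists p; rewrite inE Ap /=.
have -> : \sum_(p | A p) G p = \sum_(p | A p) \sum_(q | B q && (x q == x p)) G p / n (x p).
  apply: eq_bigr => p Ap; rewrite sumr_const -[RHS]mulr_natr.
  rewrite -[X in X%:R](cardE (x p)) -/(n (x p)) divfK //; exact: n0.
have -> : \sum_(p | B p) G' p = \sum_(q | B q) \sum_(p | A p && (x p == x q)) G' q / n (x q).
  apply: eq_bigr => p Ap; rewrite sumr_const -[RHS]mulr_natr.
  by rewrite -/(n (x p)) divfK //; exact: n1.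
rewrite (exchange_big_dep B) /=; last by move=> p q _ /andP[].
apply: eq_bigr => q Bq; apply: eq_big => [p|p /andP[Ap /andP[_ /eqP e]]].
  by rewrite Bq eq_sym.
by rewrite (GE p q) // e.
Qed.

(** When the [x p] sum to zero, the sum of the nonnegative [(x i - x j) * (g i - g j)] over all
    pairs is [2 * #|T|] times the sum in question. *)
Lemma chebyshev_sum_gt0 (R : realFieldType) (T : finType) (x g : T -> R) :
  \sum_p x p = 0 -> (forall p q, x p < x q -> g p <= g q) ->
  (exists p q, x p < x q /\ g p < g q) -> 0 < \sum_p x p * g p.
Proof.
move=> x0 mono [p [q [xpq gpq]]].
have ge0 i j : 0 <= (x i - x j) * (g i - g j).
  have [lt|gt|->] := ltgtP (x i) (x j); last by rewrite subrr mul0r.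
    by apply: mulr_le0; rewrite subr_le0 ?mono // ltW.
  by apply: mulr_ge0; rewrite subr_ge0 ?mono // ltW.
have : 0 < \sum_i \sum_j (x i - x j) * (g i - g j).
  rewrite (bigD1 p) //= (bigD1 q) //=; apply: ltr_pwDl; last by apply: sumr_ge0 => i _; apply: sumr_ge0.
  by apply: ltr_pwDl; [nra|apply: sumr_ge0].
have -> : \sum_i \sum_j (x i - x j) * (g i - g j) = 2 * #|T|%:R * \sum_p x p * g p.
  transitivity (\sum_i (#|T|%:R * (x i * g i) - (x i * \sum_j g j) - (\sum_j x j) * g i + \sum_j x j * g j)).
    apply: eq_bigr => i _; rewrite mulr_sumr mulr_suml mulr_natl -sumr_const -!sumrB -big_split /=.
    by apply: eq_bigr => j _; ring.
  rewrite big_split /= !sumrB sumr_const -mulr_sumr -mulr_suml -mulr_sumr x0 !mul0r !subr0 -mulr_natl.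
  by rewrite -[#|xpredT|]/#|T|; ring.
by rewrite -mulrA pmulr_rgt0 // => h; rewrite -(pmulr_rgt0 _ (x := #|T|%:R)) // ltr0n; apply/card_gt0P; exists p.
Qed.

(** * Roots of unity as weights of the runs *)

Section Weights.
Variables (R : realType) (T : finType) (pt : T -> R[i]) (col : T -> bool) (arg : T -> R).
Hypothesis arg_itv : forall p, 0 <= arg p < 2 * pi.
Hypothesis arg_sep : forall p q, col p != col q -> 0 < dotc (pt p - pt q) (cis (arg p)).
Variable p0 : T.

Local Notation Re := complex.Re.
Local Notation Im := complex.Im.
Local Notation M := #|T|.
Local Notation P := (cyc_point arg p0).
Local Notation C := (cyc_col col arg p0).
Local Notation N := (changes C M).
Local Notation dir u p := (dotc u (cis (arg p))).

(** Run numbers count only modulo [N], so a run that crosses the end of the period still has a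
    single weight. *)
Definition weight p : R[i] := zeta R N ^+ changes C (cyc_index arg p).

Section OneDirection.
Variable u : R[i].
Hypotheses (u0 : u != 0) (lku : linked pt col u).

(** Here [k] is the last run of the rising half, each half has [K + 1] runs, and [d p] counts the
    runs from [p], or from its mirror image in the rising half, up to run [k]. The weights of linked
    points are symmetric about the angle [pi * (2 * k + 1) / N]. *)
Lemma reflection_weights : exists k K (d : T -> nat),
  [/\ N = (2 * K).+2,
      forall p q, col p != col q -> detc u (pt p) = detc u (pt q) ->
        weight p * weight q = zeta R N ^+ (2 * k).+1,
      forall p, (d p <= K)%N /\ (weight p * zeta R N ^+ d p = zeta R N ^+ k \/
                                 weight p = zeta R N ^+ (k.+1 + d p)),
      forall p q, detc u (pt p) < detc u (pt q) -> (d q <= d p)%N &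
      (0 < K)%N -> exists p q, detc u (pt p) < detc u (pt q) /\ (d q < d p)%N] /\
  (forall p q, 0 < dir u p -> dir u q < 0 -> weight p != weight q).
Proof.
have [s [e [H top bot]]] := halves arg_itv arg_sep p0 u0 lku.
have perC i : C (i + M)%N = C i by exact: cyc_colD.
set x := (fun i => _) in H.
have lse := refl_se H; have let' := refl_et H.
set k := changes C e.-1; pose K := (k - changes C s)%N.
have NE : N = (2 * K).+2 := reflect_total perC H.
have N0 : (0 < N)%N by rewrite NE.
have prim := zeta_prim_root R N0.
have wP i : weight (P i) = zeta R N ^+ changes C i.
  rewrite /weight cyc_indexK {2}(divn_eq i M) addnC changes_periodM //.
  by rewrite exprD mulnC exprM (prim_expr_order prim) expr1n mulr1.
have find p : exists2 i, (s <= i < s + M)%N & P i = p by exact: cyc_surj.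
have bnd i : (s <= i < e)%N -> (changes C s <= changes C i <= k)%N.
  by move=> /andP[i1 i2]; rewrite !leq_changes //; lia.
have linkE i j : (s <= i < e)%N -> (e <= j < s + M)%N -> x i = x j ->
  (changes C i + changes C j)%N = (2 * k).+1 by exact: reflect_sum.
(* Each point is represented by an index of the rising half at its height: its own or one linked to
   it. *)
have /choice[d dP] : forall p : T, exists d : nat, exists2 i : nat, (s <= i < e)%N &
    [/\ x i = detc u (pt p), d = (k - changes C i)%N &
       changes C i = changes C i /\ (weight p = weight (P i) \/
       weight p = zeta R N ^+ ((2 * k).+1 - changes C i))].
  move=> p; have [i /andP[i1 i2] <-] := find p.
  have [lt|ge] := ltnP i e.
    by exists (k - changes C i)%N, i; [rewrite i1|split => //; split => //; left].
  have iJ : (e <= i < s + M)%N by rewrite ge.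
  have [j jI xj] := refl_link2 H iJ.
  exists (k - changes C j)%N, j => //; split => //; split => //; right.
  by rewrite wP -(linkE _ _ jI iJ xj) addKn.
exists k, K, d; split; first split => //.
- move=> p q; have [i iI <-] := find p; have [j jI <-] := find q.
  move=> ne xE; rewrite !wP -exprD; congr (_ ^+ _).
  have [di|di] := ltnP i e; have [dj|dj] := ltnP j e.
  + have iI' : (s <= i < e)%N by lia.
    have jI' : (s <= j < e)%N by lia.
    have := top _ iI'; have := top _ jI'.
    by case: (link_opposite arg_sep u0 ne xE) => -[h1 h2]; [rewrite (lt_gtF h2)|rewrite (lt_gtF h1)].
  + by apply: linkE => //; lia.
  + by rewrite addnC; apply: linkE => //; lia.
  + have iI' : (e <= i < s + M)%N by lia.
    have jI' : (e <= j < s + M)%N by lia.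
    have := bot _ iI'; have := bot _ jI'.
    by case: (link_opposite arg_sep u0 ne xE) => -[h1 h2]; [rewrite (lt_gtF h1)|rewrite (lt_gtF h2)].
- move=> p; have [i iI [_ -> [_ wE]]] := dP p; have := bnd i iI; split; first by rewrite /K; lia.
  case: wE => ->; [left|right]; first by rewrite wP -exprD; congr (_ ^+ _); lia.
  by congr (_ ^+ _); lia.
- move=> p q; have [i iI [<- -> _]] := dP p; have [j jI [<- -> _]] := dP q => lt.
  by rewrite leq_sub2l // (changes_up_le H).
- move=> K0; have eI : (s <= e.-1 < e)%N by lia.
  have lt : (changes C s < changes C e.-1)%N by move: K0; rewrite /K subn_gt0.
  have [|i [/andP[i1 i2] i3 i4]] := changes_last _ lt; first lia.
  have iI : (s <= i < e)%N by lia.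
  (* The index [j] behind [d (P l)] need not be [l], but both are linked to [m] and so have the same
     run number. *)
  have dE l : (s <= l < e)%N -> d (P l) = (k - changes C l)%N.
    move=> lI; have [j jI [jx -> _]] := dP (P l).
    have [m mJ xm] := refl_link1 H lI.
    have h1 := linkE _ _ lI mJ (esym xm).
    have h2 : x j = x m by rewrite jx xm.
    by have h3 := linkE _ _ jI mJ h2; congr (_ - _)%N; lia.
  exists (P i), (P e.-1); rewrite !dE // i4; split; last by have := bnd _ iI; lia.
  by apply: (refl_up H) => //; lia.
- move=> p q; have [i iI <-] := find p; have [j jI <-] := find q => hp hq.
  have di : (i < e)%N by rewrite ltnNge; apply/negP => h; have := bot i; rewrite h; case/andP: iI => _ ->; move=> /(_ isT); rewrite (lt_gtF hp).
  have dj : (e <= j)%N by rewrite leqNgt; apply/negP => h; have := top j; rewrite h; case/andP: jI => -> _; move=> /(_ isT); rewrite (lt_gtF hq).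
  rewrite !wP (eq_prim_root_expr prim); apply: (halves_changes_neq perC H); lia.
Qed.

End OneDirection.
End Weights.

Lemma zeta_norm (R : realType) n : `|zeta R n| = 1.
Proof. by rewrite /zeta /cis normc_def /= addrC sin2cos2 subrK sqrtr1. Qed.

Lemma zeta_neq0 (R : realType) n : zeta R n != 0.
Proof. by rewrite -normr_gt0 zeta_norm. Qed.

(** * The moment map of a balanced colouring *)

Section Balanced.
Variables (R : realType) (T : finType) (pt : T -> R[i]) (col : T -> bool).
Local Notation Re := complex.Re.
Local Notation Im := complex.Im.

Definition balanced (u : R[i]) := forall x : R,
  #|[pred p | col p & detc u (pt p) == x]| = #|[pred p | ~~ col p & detc u (pt p) == x]|.

Lemma balanced_linked u : balanced u -> linked pt col u.
Proof.
move=> bal p; case cp : (col p).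
  have : (0 < #|[pred q | ~~ col q & detc u (pt q) == detc u (pt p)]|)%N.
    by rewrite -bal; apply/card_gt0P; exists p; rewrite inE cp /=.
  by case/card_gt0P => q /andP[/negbTE cq /eqP e]; exists q; rewrite ?cq.
have : (0 < #|[pred q | col q & detc u (pt q) == detc u (pt p)]|)%N.
  by rewrite bal; apply/card_gt0P; exists p; rewrite inE cp /=.
by case/card_gt0P => q /andP[cq /eqP e]; exists q; rewrite ?cq.
Qed.

Variable arg : T -> R.
Hypothesis arg_itv : forall p, 0 <= arg p < 2 * pi.
Hypothesis arg_sep : forall p q, col p != col q -> 0 < dotc (pt p - pt q) (cis (arg p)).
Variable p0 : T.
Local Notation M := #|T|.
Local Notation C := (cyc_col col arg p0).
Local Notation N := (changes C M).
Local Notation W := (weight col arg p0).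
Local Notation dir u p := (dotc u (cis (arg p))).

(* The two points of a link that is extremal for u lie in the same half with
   respect to u', because their u'-partners must lie on the inner side. *)
Lemma extremal_link u u' : u != 0 -> u' != 0 -> linked pt col u -> linked pt col u' -> detc u u' != 0 ->
  exists a b, [/\ col a != col b, detc u (pt a) = detc u (pt b) & 0 < dir u' a * dir u' b].
Proof.
move=> u0 u'0 lk lk' duu'.
pose a := [arg max_(p > p0) detc u (pt p)]%O.
have amax p : detc u (pt p) <= detc u (pt a).
  by rewrite /a; case: arg_maxP => // i _ /(_ p isT).
have [b cb xb] := lk a.
(* The [u']-partner of [p] is [p] moved by [k * u']. Maximality of [p] gives [k * detc u u' <= 0]
   and separation gives [k * dir u' p < 0], so the two factors share a sign. *)
have side p : detc u (pt p) = detc u (pt a) -> 0 < dir u' p * detc u u'.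
  move=> e; have [q cq xq] := lk' p.
  have h : detc u' (pt q - pt p) = 0 by rewrite detcBr xq subrr.
  have qp := detc_eq0P u'0 h; set k := (_ / _) in qp.
  have := arg_sep cq; rewrite eq_sym in cq; have := arg_sep cq.
  have -> : pt p - pt q = (- k)%:C%C * u' by rewrite -opprB qp rmorphN mulNr.
  have := amax q; rewrite -e -subr_le0 -detcBr qp !dotcZr.
  have -> : detc u (k%:C%C * u') = k * detc u u'.
    by case: (u) (u') => x y [z t]; rewrite /detc /=; ring.
  rewrite mulNr oppr_gt0 => h1 h2 _.
  have : dir u' p != 0 by apply: contraTneq h2 => ->; rewrite mulr0 ltxx.
  have hk : k != 0 by apply: contraTneq h2 => ->; rewrite mul0r ltxx.
  move: (dir u' p) h2 duu' h1 hk => X; move: (detc u u') => Y h2 Y0 h1 k0 X0.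
  have kk : 0 < k ^+ 2 by rewrite lt_def sqr_ge0 expf_neq0.
  have : 0 <= (k * X) * (k * Y) by rewrite mulr_le0 // ltW.
  have -> : k * X * (k * Y) = k ^+ 2 * (X * Y) by ring.
  by rewrite pmulr_rge0 // => ge; rewrite lt_def ge mulf_neq0.
exists a, b; split=> //; first by rewrite eq_sym.
have := side a erefl; have := side b xb.
move: (dir u' a) (dir u' b) (detc u u') => X Y Z h1 h2.
have : 0 < (Y * Z) * (X * Z) by rewrite mulr_gt0.
have -> : Y * Z * (X * Z) = Z ^+ 2 * (X * Y) by ring.
have Z2 : 0 < Z ^+ 2.
  by rewrite lt_def sqr_ge0 expf_neq0 //; apply: contraTneq h1 => ->; rewrite mulr0 ltxx.
by rewrite pmulr_rgt0.
Qed.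

(** For a [u]-link [a], [b] inside one half with respect to [u'], the [u']-partner [q] of [a] lies
    in the other half. So [W q] differs from [W b], and [w' = W a * W q] from [w = W a * W b]. *)
Lemma link_weight_neq u u' w w' : u != 0 -> u' != 0 -> linked pt col u -> linked pt col u' -> detc u u' != 0 ->
  (forall p q, col p != col q -> detc u (pt p) = detc u (pt q) -> W p * W q = w) ->
  (forall p q, col p != col q -> detc u' (pt p) = detc u' (pt q) -> W p * W q = w') ->
  w != w'.
Proof.
move=> u0 u'0 lk lk' duu' hw hw'.
have [a [b [cab xab dab]]] := extremal_link u0 u'0 lk lk' duu'.
have [q cq xq] := lk' a.
have [k [K [d [[NE _ _ _ _] halvesW]]]] := reflection_weights arg_itv arg_sep p0 u'0 lk'.
have Wa : W a != 0.
  by rewrite expf_neq0 // zeta_neq0.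
have qb : W q != W b.
  rewrite eq_sym in cq.
  case: (link_opposite arg_sep u'0 cq (esym xq)) => -[ha hq].
    by rewrite eq_sym; apply: halvesW => //; rewrite -(pmulr_rgt0 _ ha).
  by apply: halvesW => //; rewrite -(nmulr_rgt0 _ ha).
rewrite -(hw _ _ cab xab) -(hw' a q) // 1?eq_sym //.
by apply: contra qb => /eqP/(mulfI Wa) ->.
Qed.

Definition centre : R[i] := (\sum_p pt p) / M%:R.

Definition moment (u : R[i]) : R[i] := \sum_p (detc u (pt p - centre))%:C%C * W p.

Lemma sum_detc_centre u : \sum_p detc u (pt p - centre) = 0.
Proof.
have M0 : M%:R != 0 :> R[i] by rewrite pnatr_eq0 -lt0n; apply/card_gt0P; exists p0.
have dsum (I : finType) (f : I -> R[i]) : \sum_p detc u (f p) = detc u (\sum_p f p).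
  by rewrite /detc !raddf_sum /= !mulr_sumr -sumrB.
rewrite dsum sumrB sumr_const -[_ *+ _]mulr_natr -[#|xpredT|]/M divfK // subrr.
by rewrite /detc /= !mulr0 subrr.
Qed.

Lemma weight_unit p : (W p)^* = (W p)^-1.
Proof.
have W0 : W p != 0 by rewrite expf_neq0 // zeta_neq0.
by apply: (mulfI W0); rewrite divff // -normCK normrX zeta_norm !expr1n.
Qed.

(** Each line has equally many points of both colours, and [W q = w * (W p)^*] across a link; so the
    part of the moment over one colour is [w] times the conjugate of the part over the other. *)
Lemma moment_reflect u w : balanced u ->
  (forall p q, col p != col q -> detc u (pt p) = detc u (pt q) -> W p * W q = w) ->
  moment u = w * (moment u)^*.
Proof.
move=> bal hw.
pose x p := detc u (pt p - centre).
have W0 p : W p != 0 by rewrite expf_neq0 // zeta_neq0.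
have xE p q : detc u (pt p) = detc u (pt q) -> x p = x q by move=> e; rewrite /x !detcBr e.
have WE p q : col p != col q -> detc u (pt p) = detc u (pt q) -> W q = w * (W p)^*.
  by move=> c e; rewrite weight_unit // -(hw p q) // mulrAC divff // mul1r.
have mc : (moment u)^* = \sum_p (x p)%:C%C * (W p)^*.
  rewrite /moment rmorph_sum; apply: eq_bigr => p _; rewrite rmorphM /=.
  by congr (_ * _); exact: conjc_real.
rewrite mc mulr_sumr /moment (bigID col) [RHS](bigID col) /= addrC; congr (_ + _).
  apply/esym/(sum_matched_fibres (x := fun p => detc u (pt p))) => [//|p q cp cq e].
  by rewrite -/(x _) (xE _ _ e) (WE _ _ _ e) ?cp ?(negbTE cq) //; ring.
apply: (sum_matched_fibres (x := fun p => detc u (pt p))) => [//|p q cp cq e].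
by rewrite -/(x _) (xE _ _ e) (WE _ _ _ (esym e)) ?cp ?(negbTE cq) //; ring.
Qed.

(** Turned back by the axis [h] of the reflection, the weight of [p] has real part [cos (th (d p))],
    which does not decrease with the height of [p]. Chebyshev's inequality then makes the real part
    of [moment u * h^*] positive. *)
Lemma moment_neq0 u : u != 0 -> linked pt col u -> (2 < N)%N -> moment u != 0.
Proof.
move=> u0 lk N2.
have [k [K [d [[NE _ Wd mono strict] _]]]] := reflection_weights arg_itv arg_sep p0 u0 lk.
have K0 : (0 < K)%N by lia.
have N0 : (0 < N)%N by lia.
have NR : 0 < N%:R :> R by rewrite ltr0n.
pose h : R[i] := cis (pi * (2 * k%:R + 1) / N%:R).
pose th m : R := pi * (2 * m%:R + 1) / N%:R.
pose x p := detc u (pt p - centre).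
have p0R := pi_gt0 R.
have WE p : Re (W p * h^*) = cos (th (d p)).
  have zX m : zeta R N ^+ m = cis (2 * pi / N%:R * m%:R) by exact: cisX.
  have hc : h^* = cis (- (pi * (2 * k%:R + 1) / N%:R)) by rewrite /h /cis cosN sinN.
  have [_ [e|->]] := Wd p; last first.
    rewrite zX hc -cisD /= /th; congr cos; rewrite natrD -natr1; field; exact: lt0r_neq0.
  have z0 := expf_neq0 (d p) (zeta_neq0 R N).
  have -> : W p = cis (2 * pi / N%:R * (k%:R - (d p)%:R)).
    apply: (mulIf z0); rewrite e !zX -cisD; congr cis; ring.
  rewrite hc -cisD /= /th -cosN; congr cos; field; exact: lt0r_neq0.
(* The bound [d p <= K] and [N = 2 * K + 2] keep the angles where [cos] is decreasing. *)
have thI p : th (d p) \in `[0, pi].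
  have [dK _] := Wd p; have := dK; rewrite -(ler_nat R) => dK'.
  have d0 : 0 <= (d p)%:R :> R by rewrite ler0n.
  rewrite in_itv /= /th; apply/andP; split; first by rewrite divr_ge0 ?mulr_ge0 ?ltW //; lra.
  rewrite ler_pdivrMr // ler_pM2l //.
  by rewrite NE -[(2 * K).+2]addn2 natrD natrM; lra.
have : 0 < \sum_p x p * cos (th (d p)).
  have thlt i j : (i < j)%N -> th i < th j.
    by move=> ij; rewrite /th ltr_pM2r ?invr_gt0 // ltr_pM2l // ltrD2r ltr_pM2l // ltr_nat.
  have xlt p q : (x p < x q) = (detc u (pt p) < detc u (pt q)) by rewrite /x !detcBr ltrD2r.
  apply: chebyshev_sum_gt0; first exact: sum_detc_centre.
    move=> p q; rewrite xlt => /mono; rewrite leq_eqVlt => /orP[/eqP -> //|lt].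
    by rewrite ltW // ltr_cos // thlt.
  have [p [q [h1 h2]]] := strict K0; exists p, q; rewrite xlt; split => //.
  by rewrite ltr_cos // thlt.
apply: contraTneq => m0; rewrite -leNgt.
have -> : \sum_p x p * cos (th (d p)) = Re (moment u * h^*).
  rewrite /moment mulr_suml raddf_sum; apply: eq_bigr => p _.
  rewrite -WE -mulrA /= -/(x p); move: (W p * h^*) => [a b] /=; ring.
by rewrite m0 mul0r.
Qed.

Lemma moment_linear u : moment u = (Re u)%:C%C * moment 1 + (Im u)%:C%C * moment 'i%C.
Proof.
rewrite /moment !mulr_sumr -big_split; apply: eq_bigr => p _ /=.
rewrite !mulrA -mulrDl -!rmorphM -rmorphD /=; congr (_%:C%C * _).
by case: u (pt p - centre) => a b [c e]; rewrite /detc /=; ring.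
Qed.

End Balanced.

(** * Separation *)

Section Separation.
Variable R : realType.
Implicit Types (x y z d v : R[i]) (A S : set R[i]).
Local Notation Re := complex.Re.
Local Notation Im := complex.Im.

Definition convex_closed A := forall x y (t : R), A x -> A y -> 0 <= t <= 1 ->
  A (t%:C%C * x + (1 - t)%:C%C * y).

Lemma convex_closed0 A d (t : R) : convex_closed A -> A d -> A (t%:C%C * d) -> t <= 0 -> A 0.
Proof.
move=> cA Ad Atd t0.
have n0 : 1 - t != 0 by apply: lt0r_neq0; lra.
have -> : 0 = (1 - t)^-1%:C%C * (t%:C%C * d) + (1 - (1 - t)^-1)%:C%C * d.
  rewrite mulrA -rmorphM -mulrDl -rmorphD /=.
  have -> : (1 - t)^-1 * t + (1 - (1 - t)^-1) = 0 by field.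
  by rewrite mul0r.
apply: cA => //; rewrite invr_ge0 invf_le1 ?subr_gt0 ?subr_ge0; lra.
Qed.

(** Where [a] vanishes, [b] decides; elsewhere a small multiple of [b] cannot outweigh [a]. *)
Lemma uniform_perturbation (T : eqType) (a b : T -> R) (s : seq T) :
  (forall p, p \in s -> 0 < a p \/ a p = 0 /\ 0 < b p) ->
  exists2 e, 0 < e & forall e', 0 < e' <= e -> forall p, p \in s -> 0 < a p + e' * b p.
Proof.
elim: s => [|q s IH] h; first by exists 1.
have [|e e0 he] := IH; first by move=> p ps; apply: h; rewrite inE ps orbT.
have [aq|[aq bq0]] := h q (mem_head _ _); last first.
  exists e => // e' ee p; rewrite inE => /orP[/eqP ->|]; last exact: he.
  by rewrite aq add0r mulr_gt0 //; case/andP: ee.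
have n1 : 0 < 1 + `|b q| by have := normr_ge0 (b q); lra.
exists (Num.min e (a q / (1 + `|b q|))); first by rewrite lt_min e0 divr_gt0.
move=> e' /andP[e'0]; rewrite le_min ler_pdivlMr // => /andP[e1 e2] p.
rewrite inE => /orP[/eqP ->|]; last by apply: he; rewrite e'0.
have := ler_norm (- b q); rewrite normrN; nra.
Qed.

(* Farkas' lemma in the plane, by induction on the number of points: a new
   point d on the wrong side of v forces the half-plane to be bounded by a line
   close to the one through d. *)
Lemma open_halfplane A (s : seq R[i]) : convex_closed A -> (forall x, x \in s -> A x) -> ~ A 0 ->
  exists v, forall x, x \in s -> 0 < dotc x v.
Proof.
move=> cA; elim: s => [|d s IH] sA A0; first by exists 0.
have [|//|v hv] := IH; first by move=> x xs; apply: sA; rewrite inE xs orbT.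
have [dv|dv] := ltP 0 (dotc d v).
  by exists v => x; rewrite inE => /orP[/eqP ->|/hv].
have Ad : A d by apply: sA; rewrite mem_head.
have d0 : d != 0 by apply: contra_notN A0 => /eqP <-.
have ddp := dotc_gt0 d0.
pose w : R[i] := (- Im d +i* Re d)%C.
have dw x : dotc x w = detc d x by rewrite /dotc /detc /=; ring.
(* In [zero_side], a point on the line through 0 and [d] lies on the ray of [d], since otherwise 0
   would be between them. *)
have sA' x : x \in s -> A x by move=> xs; apply: sA; rewrite inE xs orbT.
have zero_side x : x \in s -> detc d x = 0 -> 0 < dotc x d.
  move=> xs e; rewrite ltNge; apply/negP => h; apply: A0.
  apply: (@convex_closed0 _ d (dotc d x / dotc d d)) => //.
    by rewrite -detc_eq0P //; apply: sA'.
  by rewrite pmulr_lle0 ?invr_gt0 //; rewrite /dotc mulrC [X in _ + X]mulrC.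
(* With all points on one closed side of that line, its normal tilted slightly towards [d] is
   positive on them and on [d]. *)
have build (sg : R) : (forall x, x \in s -> 0 <= sg * detc d x) -> sg != 0 ->
    exists v, forall x, x \in d :: s -> 0 < dotc x v.
  move=> h sg0.
  have [x xs|e e0 he] := @uniform_perturbation _ (fun x => sg * detc d x) (fun x => dotc x d) s.
    have := h x xs; rewrite le_eqVlt => /orP[/eqP/esym e|]; [right|by left].
    by rewrite e; split => //; apply: zero_side => //; apply/eqP; move/eqP: e; rewrite mulf_eq0 (negbTE sg0).
  exists (sg%:C%C * w + e%:C%C * d) => x.
  have -> : dotc x (sg%:C%C * w + e%:C%C * d) = sg * detc d x + e * dotc x d.
    by rewrite /dotc /detc /w; case: (d) (x) => a b [a' b'] /=; ring.
  rewrite inE => /orP[/eqP ->|xs]; last by apply: he => //; rewrite e0 lexx.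
  have -> : detc d d = 0 by rewrite /detc; ring.
  by rewrite mulr0 add0r mulr_gt0.
have [hp|/existsNP[x /not_implyP[xs /negP]]] := pselect (forall x, x \in s -> 0 <= 1 * detc d x).
  by apply: (build 1).
have [hm _|/existsNP[y /not_implyP[ys /negP]]] := pselect (forall x, x \in s -> 0 <= -1 * detc d x).
  by apply: (build (-1)); rewrite // oppr_eq0 oner_neq0.
rewrite -!ltNge mul1r mulN1r oppr_lt0 => dy dx; exfalso; apply: A0.
(* With [x] and [y] strictly on different sides, their segment meets the line at [z], where [v] is
   positive. As [v] is not positive at [d], [z] is a nonpositive multiple of [d], which puts 0 into
   [A]. *)
pose t := detc d y / (detc d y - detc d x).
have D0 : 0 < detc d y - detc d x by lra.
have t01 : 0 <= t <= 1.
  by rewrite /t divr_ge0 ?(ltW dy) ?(ltW D0) //= ler_pdivrMr // mul1r; lra.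
pose z := t%:C%C * x + (1 - t)%:C%C * y.
have Az : A z by apply: cA => //; apply: sA'.
have zE u : dotc z u = t * dotc x u + (1 - t) * dotc y u.
  by rewrite /dotc /z; case: (x) (y) => a b [a' b'] /=; ring.
have dz : detc d z = 0.
  rewrite -dw zE !dw /t; field; exact: lt0r_neq0.
have zv : 0 < dotc z v.
  by rewrite zE; have := hv _ xs; have := hv _ ys; nra.
rewrite (detc_eq0P d0 dz) in Az zv.
apply: convex_closed0 Az _ => //; rewrite leNgt; apply/negP => h.
by move: zv; rewrite dotcZr; nra.
Qed.

Lemma convex_hull_closed S : convex_closed (convex_hull S).
Proof.
move=> x y t hx hy t01 A [cA SA].
have t01' : Itv.spec (@Itv.num_sem R) (Itv.Real `[0%Z, 1%Z]) t by rewrite /= /Itv.num_sem /= num_real /= in_itv.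
have Ax : A x by exact: hx.
have Ay : A y by exact: hy.
have /set_mem := cA x y (Itv.mk t01') (mem_set Ax) (mem_set Ay).
suff -> : t%:C%C * x + (1 - t)%:C%C * y = conv (Itv.mk t01') (x : convex_lmodType (Rcomplex R)) y by [].
have scaleE (a : R) (z : R[i]) : a%:C%C * z = a *: (z : Rcomplex R).
  by case: z => b c; apply/eqP; rewrite eq_complex /= !mul0r subr0 addr0 !eqxx.
by rewrite !scaleE.
Qed.

Lemma sub_convex_hull S : S `<=` convex_hull S.
Proof. by move=> x Sx A [_ SA]; apply: SA. Qed.

(** Apply the half-plane lemma to the convex set of all [p - q] with [q] in the hull; it avoids
    0. *)
Lemma separating_direction S (s : seq R[i]) p : (forall q, q \in s -> S q) ->
  ~ convex_hull S p -> exists v, forall q, q \in s -> 0 < dotc (p - q) v.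
Proof.
move=> sS hp; pose A : set R[i] := [set x | convex_hull S (p - x)].
have cA : convex_closed A.
  move=> x y t; rewrite /A /= => hx hy t01.
  have -> : p - (t%:C%C * x + (1 - t)%:C%C * y) = t%:C%C * (p - x) + (1 - t)%:C%C * (p - y).
    by rewrite rmorphB rmorph1; ring.
  exact: convex_hull_closed.
have [x /mapP[q qs ->]||v hv] := @open_halfplane A [seq p - q | q <- s] cA.
- by rewrite /A /= subKr; apply: sub_convex_hull; apply: sS.
- by rewrite /A /= subr0.
by exists v => q qs; apply: hv; apply: map_f.
Qed.

End Separation.

(** * Cross ratios of roots of unity *)

Local Notation integralZ x := (integralOver (intmul 1) x).

Section Integrality.
Variable F : fieldType.
Implicit Types x y z : F.

Lemma integral_root1 n x : (0 < n)%N -> x ^+ n = 1 -> integralZ x.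
Proof.
move=> n0 xn; exists ('X^n - 1); first exact: monic_Xn_sub_1.
by rewrite rmorphB rmorph1 /= map_polyXn rootE !hornerE xn subrr.
Qed.

Lemma integralX x m : integralZ x -> integralZ (x ^+ m).
Proof.
move=> ix; elim: m => [|m IH]; first exact: integral1.
by rewrite exprS; apply: integral_mul.
Qed.

Lemma integral_sum (I : Type) (r : seq I) (Q : pred I) (f : I -> F) :
  (forall i, Q i -> integralZ (f i)) -> integralZ (\sum_(i <- r | Q i) f i).
Proof. by move=> h; apply: big_ind => // [|x y]; [exact: (integral_nat _ 0)|exact: integral_add]. Qed.

Lemma integral_prod (I : Type) (r : seq I) (Q : pred I) (f : I -> F) :
  (forall i, Q i -> integralZ (f i)) -> integralZ (\prod_(i <- r | Q i) f i).
Proof. by move=> h; apply: big_ind => // [|x y]; [exact: integral1|exact: integral_mul]. Qed.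

Lemma integral_1BX_div x m : integralZ x -> x != 1 -> integralZ ((1 - x ^+ m) / (1 - x)).
Proof.
move=> ix x1; have n0 : 1 - x != 0 by rewrite subr_eq0 eq_sym.
rewrite -opprB subrX1 -mulNr opprB mulrAC divff // mul1r.
by apply: integral_sum => i _; apply: integralX.
Qed.

Lemma integral_morph (G : fieldType) (f : {rmorphism F -> G}) x : integralZ x <-> integralZ (f x).
Proof.
have e (p : {poly int}) : map_poly intr p = map_poly f (map_poly intr p) :> {poly G}.
  by rewrite -map_poly_comp; apply: eq_map_poly => i /=; rewrite rmorph_int.
by split=> -[p mp rp]; exists p => //; move: rp; rewrite e fmorph_root.
Qed.

(** Both sides are the value at 1 of [('X^p - 1) / ('X - 1)]. *)
Lemma prod_1_sub_root p (w : F) : p.-primitive_root w ->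
  \prod_(0 <= i < p.-1) (1 - w ^+ i.+1) = p%:R.
Proof.
move=> prim; have p0 := prim_order_gt0 prim.
have := factor_Xn_sub_1 prim; rewrite -{1}(prednK p0) big_nat_recl // expr0 polyC1 subrX1.
move=> /(mulfI (monic_neq0 (monicXsubC 1))) /(congr1 (fun q => q.[1])).
rewrite horner_prod horner_sum => e.
transitivity (\prod_(0 <= i < p.-1) ('X - (w ^+ i.+1)%:P).[1]).
  by apply: eq_bigr => i _; rewrite !hornerE.
rewrite e (eq_bigr (fun=> 1)); first by rewrite sumr_const card_ord.
by move=> i _; rewrite hornerXn expr1n.
Qed.

(* For p dividing the order of x and w a power of x of order p, the conjugates
   1 - w^i all divide each other, so (1 - w)^(p-1) is associated with p. *)
Lemma root1_prime_div n x : (0 < n)%N -> x ^+ n = 1 -> x != 1 ->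
  exists2 p, prime p & integralZ (p%:R / (1 - x) ^+ p.-1).
Proof.
move=> n0 xn x1; have ix := integral_root1 n0 xn.
have [k prim _] := prim_order_exists n0 xn.
have k1 : (1 < k)%N.
  rewrite ltnNge; apply/negP => k1; have k0 := prim_order_gt0 prim.
  by have := prim_expr_order prim; rewrite (_ : k = 1%N); [move/eqP: x1|lia].
exists (pdiv k); first exact: pdiv_prime.
have primw := dvdn_prim_root prim (pdiv_dvd k).
set p := pdiv k in primw *; set w := x ^+ _ in primw.
have p1 : (1 < p)%N by exact: prime_gt1 (pdiv_prime k1).
have iw : integralZ w by exact: integralX.
have w1 : w != 1.
  apply/eqP => e; have := prim_order_dvd primw 1; rewrite expr1 e eqxx => /esym/esym.
  by rewrite dvdn1 => /eqP pp; move: p1; rewrite pp.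
have n1 : 1 - w != 0 by rewrite subr_eq0 eq_sym.
(* As [w] is a power of [x], [(1 - w) / (1 - x)] is integral, and [w] may replace [x]. *)
have -> : p%:R / (1 - x) ^+ p.-1 = p%:R / (1 - w) ^+ p.-1 * ((1 - w) / (1 - x)) ^+ p.-1.
  by rewrite expr_div_n mulrA divfK // expf_neq0.
apply: integral_mul; last by apply: integralX; apply: integral_1BX_div.
rewrite -(prod_1_sub_root primw).
have -> : (1 - w) ^+ p.-1 = \prod_(0 <= i < p.-1) (1 - w) by rewrite prodr_const_nat subn0.
rewrite -prodf_div; apply: integral_prod => i _.
exact: integral_1BX_div.
Qed.

(* The two primes p coming from c - b and d - a satisfy p <= 2^(p-1), whence 4^m. *)
Lemma cross_ratio_root1_integral n (a b c d : F) : (0 < n)%N ->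
  a ^+ n = 1 -> b ^+ n = 1 -> c ^+ n = 1 -> d ^+ n = 1 -> c != b -> d != a ->
  exists m D, [/\ (0 < m)%N, (0 < D <= 4 ^ m)%N &
    integralZ (((c - a) * (d - b) / ((c - b) * (d - a))) ^+ m * D%:R)].
Proof.
move=> n0 an bn cn dn cb da.
have nz x : x ^+ n = 1 -> x != 0.
  by move=> xn; apply/eqP => x0; move: xn; rewrite x0 expr0n eqn0Ngt n0 => /esym/eqP; rewrite oner_eq0.
have div1 x y : x ^+ n = 1 -> y ^+ n = 1 -> (x / y) ^+ n = 1.
  by move=> xn yn; rewrite expr_div_n xn yn divr1.
have neq1 x y : y ^+ n = 1 -> y != x -> x / y != 1.
  move=> yn; apply: contraNneq => e; apply/eqP.
  by rewrite -[LHS]mul1r -e divfK ?nz.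
have [p pp ip] := root1_prime_div n0 (div1 _ _ bn cn) (neq1 _ _ cn cb).
have [q pq iq] := root1_prime_div n0 (div1 _ _ an dn) (neq1 _ _ dn da).
have p1 := prime_gt1 pp; have q1 := prime_gt1 pq.
(* The exponent is a common multiple of [p.-1] and [q.-1], so prime powers clear both
   denominators. *)
exists (p.-1 * q.-1)%N, (p ^ q.-1 * q ^ p.-1)%N; split.
- by rewrite muln_gt0; apply/andP; split; lia.
- rewrite muln_gt0 !expn_gt0 !(ltnW p1, ltnW q1) /=.
  have le2 k : (1 < k)%N -> (k <= 2 ^ k.-1)%N.
    by case: k => // k _; apply: ltn_expl.
  rewrite -[4%N]/(2 * 2)%N expnMn; apply: leq_mul.
    by rewrite expnM leq_exp2r ?le2 //; lia.
  by rewrite mulnC expnM leq_exp2r ?le2 //; lia.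
have c0 := nz _ cn; have d0 := nz _ dn.
have cbn : c - b != 0 by rewrite subr_eq0.
have dan : d - a != 0 by rewrite subr_eq0.
have -> : ((c - a) * (d - b) / ((c - b) * (d - a))) ^+ (p.-1 * q.-1) * (p ^ q.-1 * q ^ p.-1)%:R
  = ((c - a) * (d - b) * (c^-1 * d^-1)) ^+ (p.-1 * q.-1) *
    ((p%:R / (1 - b / c) ^+ p.-1) ^+ q.-1 * (q%:R / (1 - a / d) ^+ q.-1) ^+ p.-1).
  have -> : (1 - b / c) = (c - b) / c by rewrite mulrBl divff.
  have -> : (1 - a / d) = (d - a) / d by rewrite mulrBl divff.
  rewrite natrM !natrX !expr_div_n -!exprM [(q.-1 * p.-1)%N]mulnC !exprMn !exprVn.
  have := expf_neq0 (p.-1 * q.-1) cbn; have := expf_neq0 (p.-1 * q.-1) dan.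
  have := expf_neq0 (p.-1 * q.-1) c0; have := expf_neq0 (p.-1 * q.-1) d0.
  move: (c ^+ _) (d ^+ _) ((c - b) ^+ _) ((d - a) ^+ _) => s t s' t' s0 t0 s0' t0'.
  rewrite !invfM !invrK.
  by field; rewrite ?s0 ?t0 ?s0' ?t0'.
have int1 x : x ^+ n = 1 -> integralZ x by exact: integral_root1.
have intV x : x ^+ n = 1 -> integralZ x^-1 by move=> xn; apply: int1; rewrite exprVn xn invr1.
apply: integral_mul; last by apply: integral_mul; apply: integralX.
apply: integralX; apply: integral_mul; apply: integral_mul; try apply: integral_sub; auto.
Qed.

End Integrality.

Lemma integral_rat (x : rat) : integralZ x -> x \is a Num.int.
Proof.
move=> /(integral_morph (ratr : {rmorphism rat -> algC})) [p mp rp].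
have : ratr x \in Aint.
  apply: (root_monic_Aint rp); first exact: monic_map.
  by apply/polyOverP => i; rewrite coef_map /= intr_int.
move=> /(Cint_rat_Aint (Crat_rat x)) /intrP[z e].
apply/intrP; exists z; apply: (fmorph_inj (ratr : {rmorphism rat -> algC})).
by rewrite [LHS]e rmorph_int.
Qed.

(** By coprimality [b ^+ m] divides [D ^ e], which is at most [4 ^ (m * e)]; taking [m]-th roots
    removes [m]. *)
Lemma denominator_leq (a b : int) m D e : b != 0 -> coprimez a b -> (0 < m)%N -> (0 < D <= 4 ^ m)%N ->
  (a%:~R / b%:~R : rat) ^+ m * D%:R ^+ e \is a Num.int -> (`|b| <= 4 ^ e)%N.
Proof.
move=> b0 cop m0 /andP[D0 D4] /intrP[z].
have b0' : (b%:~R : rat) != 0 by rewrite intr_eq0.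
rewrite expr_div_n mulrAC => /(canRL (divfK (expf_neq0 _ b0'))) eqz.
have {}eqz : a ^+ m * (D%:Z ^+ e) = z * b ^+ m.
  by apply: (intr_inj (R := rat)); rewrite !rmorphM !rmorphXn /= -eqz.
have : (b ^+ m %| a ^+ m * (D%:Z ^+ e))%Z by rewrite eqz dvdz_mull.
rewrite Gauss_dvdzr; last first.
  by rewrite coprimezXl // coprimez_sym coprimezXl.
rewrite dvdzE !abszX absz_nat => /dvdn_leq; rewrite expn_gt0 D0 => /(_ isT) le.
rewrite -(@leq_exp2r _ _ m) //; apply: (leq_trans le).
by rewrite expnAC; case: (e) => [|e'] //; rewrite leq_exp2r.
Qed.

(** * The maximal real subfield *)

Lemma quadratic_step (F : fieldType) (a b z : F) : z != 0 ->
  (a + b * z) * z = - b + (a + b * (z + z^-1)) * z.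
Proof. by move=> z0; field. Qed.

Section CyclotomicField.
Variables (R : realType) (n : nat) (n_ge3 : (3 <= n)%N) (K : cyclotomic_field R n).
Local Notation z := (cf_gen K).
Local Notation emb := (cf_emb K).
Local Notation t := (z + z^-1).

Let n_gt0 : (0 < n)%N. Proof. lia. Qed.

Lemma cf_gen_prim : n.-primitive_root z.
Proof. by rewrite -(fmorph_primitive_root emb) cf_emb_gen zeta_prim_root. Qed.

Lemma cf_polyP (x : K) : exists2 p : {poly K}, p \is a polyOver 1%AS & x = p.[z].
Proof. by apply/Fadjoin_polyP; rewrite cf_gen_full memvf. Qed.

Lemma emb_base (c : K) : c \in 1%VS -> exists r : rat, c = r%:A /\ emb c = ratr r.
Proof.
move=> /vlineP[r ->]; exists r; split => //.
have e : (r%:A : K) = ratr r by rewrite alg_num_field.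
by rewrite e fmorph_rat.
Qed.

Lemma zeta_conj : (zeta R n)^* = (zeta R n)^-1.
Proof. by apply: (mulfI (zeta_neq0 R n)); rewrite divff ?zeta_neq0 // -normCK zeta_norm expr1n. Qed.

(** Conjugation inverts [zeta] and fixes rational coefficients, so it amounts to evaluating at
    [z^-1]. *)
Lemma cf_conj (x : K) : exists x' : K, emb x' = (emb x)^*.
Proof.
have [p p1 ->] := cf_polyP x; exists p.[z^-1].
rewrite !horner_coef !rmorph_sum; apply: eq_bigr => i _.
have [r [_ er]] := emb_base (polyOverP p1 i).
rewrite !rmorphM /= er !rmorphXn /= fmorphV /= cf_emb_gen zeta_conj.
by rewrite fmorph_rat.
Qed.

Lemma zeta_not_real : zeta R n \isn't Num.real.
Proof.
have nR : 0 < n%:R :> R by rewrite ltr0n.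
have s0 : 0 < sin (2 * pi / n%:R : R).
  apply: sin_gt0_pi; rewrite divr_gt0 ?mulr_gt0 ?pi_gt0 //=.
  rewrite ltr_pdivrMr // mulrC ltr_pM2l ?pi_gt0 //.
  by rewrite ltr_nat.
apply/negP; rewrite realE !lecE /= => /orP[] /andP[/eqP e _]; move: s0; rewrite ?e -?e ltxx.
  by [].
by [].
Qed.

Lemma max_real_gen : t \in max_real_subfield K.
Proof. exact: memv_adjoin. Qed.

Lemma max_real_is_real y : y \in max_real_subfield K -> emb y \is Num.real.
Proof.
move=> /Fadjoin_polyP[p p1 ->]; rewrite -horner_map.
apply: rpred_horner.
  apply/polyOverP => i; rewrite coef_map /=.
  by have [r [_ ->]] := emb_base (polyOverP p1 i); apply: rpred_rat.
rewrite /= rmorphD fmorphV /= cf_emb_gen CrealE rmorphD fmorphV /= zeta_conj invrK addrC.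
by rewrite eqxx.
Qed.

(* K = M + M z for the maximal real subfield M, and z is not real. *)
Lemma real_max_real x : emb x \is Num.real -> x \in max_real_subfield K.
Proof.
pose Mr := max_real_subfield K.
have z0 : z != 0 by rewrite -(fmorph_eq0 emb) (cf_emb_gen K) zeta_neq0.
have zX i : exists a b, [/\ a \in Mr, b \in Mr & z ^+ i = a + b * z].
  elim: i => [|i [a [b [aM bM e]]]].
    by exists 1, 0; rewrite mul0r addr0 expr0 rpred1 rpred0.
  exists (- b), (a + b * t); split; [by rewrite rpredN|by rewrite rpredD ?rpredM ?max_real_gen|].
  by rewrite exprSr e quadratic_step.
have [p p1 ->] := cf_polyP x.
have [a [b [aM bM ->]]] : exists a b, [/\ a \in Mr, b \in Mr & p.[z] = a + b * z].
  rewrite horner_coef; elim/big_ind: _ => [|x1 x2 [a1 [b1 [h1 h2 ->]]] [a2 [b2 [h3 h4 ->]]]|i _].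
  - by exists 0, 0; rewrite mul0r addr0 rpred0.
  - by exists (a1 + a2), (b1 + b2); rewrite !rpredD // mulrDl addrACA.
  have [a [b [h1 h2 ->]]] := zX i.
  have pM : p`_i \in Mr by apply: (subvP (sub1v _)); exact: (polyOverP p1).
  by exists (p`_i * a), (p`_i * b); rewrite !rpredM // mulrDr mulrA.
move=> re; have bz : emb (b * z) \is Num.real.
  have -> : emb (b * z) = emb (a + b * z) - emb a by rewrite rmorphD addrAC subrr add0r.
  by rewrite rpredB // max_real_is_real.
have [b0|b0] := eqVneq b 0; first by rewrite b0 mul0r addr0.
have /negP[] := zeta_not_real; rewrite -(cf_emb_gen K).
have -> : emb z = emb (b * z) / emb b by rewrite -fmorph_div mulrAC divff // mul1r.
by rewrite rpred_div // max_real_is_real.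
Qed.

Lemma cf_separable : separable 1%AS {:K}.
Proof.
by apply/separableP => y _; apply: pcharf0_separable => p; rewrite pchar_lalg pchar_num.
Qed.

Lemma cf_galois : galois 1%AS {:K}.
Proof. by rewrite /galois sub1v cf_separable normalFieldf. Qed.

(** An automorphism sends [z] to some [z ^+ i], hence [t] to a real element, so the subfield is
    stable. *)
Lemma max_real_galois : galois 1%AS (max_real_subfield K).
Proof.
apply: (normalField_galois cf_galois); first by rewrite sub1v subvf.
apply/forall_inP => f _.
have sub : (f @: max_real_subfield K <= max_real_subfield K)%VS.
  rewrite aimg_adjoin aimg1; apply/FadjoinP; split; first exact: sub1v.
  apply: real_max_real.
  have fz : (f z) ^+ n = 1 by rewrite -rmorphXn /= (prim_expr_order cf_gen_prim) rmorph1.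
  have [i ez] := prim_rootP cf_gen_prim fz.
  by rewrite !(rmorphD, fmorphV, rmorphXn) /= ez !(rmorphD, fmorphV, rmorphXn) /=
    cf_emb_gen CrealE rmorphD fmorphV rmorphXn /= zeta_conj exprVn invrK addrC.
rewrite eqEdim sub limg_dim_eq //=.
by rewrite (eqP (AEnd_lker0 f)) capv0.
Qed.

(** A crude degree bound, from [z] being a root of ['X^n - 1]; it suffices for an estimate in terms
    of [n] alone. *)
Lemma card_max_real : (#|'Gal(max_real_subfield K / 1)%g| <= n)%N.
Proof.
rewrite -(galois_dim max_real_galois) dimv1 divn1.
apply: (leq_trans (dimvS (subvf _))).
rewrite -cf_gen_full dim_Fadjoin dimv1 muln1 -ltnS -size_minPoly.
have : minPoly 1%AS z %| 'X^n - 1.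
  apply: minPoly_dvdp; first by rewrite rpredB ?rpred1 ?rpredX //= polyOverX.
  by rewrite rootE !hornerE (prim_expr_order cf_gen_prim) subrr.
move=> /dvdp_leq; rewrite size_XnsubC // => -> //.
exact: monic_neq0 (monic_Xn_sub_1 _ n_gt0).
Qed.

(** The norm of the integral element [q ^+ m * D%:R] is [r ^+ m * D%:R ^+ #|G|], an integral
    rational and so an integer. *)
Lemma galNorm_denominator (q : K) (r : rat) (a b : int) m D :
  galNorm 1 (max_real_subfield K) q = r%:A -> r = a%:~R / b%:~R -> b != 0 -> coprimez a b ->
  (0 < m)%N -> (0 < D <= 4 ^ m)%N -> integralZ (q ^+ m * D%:R) -> (`|b| <= 4 ^ n)%N.
Proof.
move=> nq rE b0 cop m0 D4 iq.
pose G := 'Gal(max_real_subfield K / 1)%g.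
apply: (@leq_trans (4 ^ #|G|)); last by rewrite leq_pexp2l // card_max_real.
apply: (denominator_leq b0 cop m0 D4); rewrite -rE.
have : integralZ (galNorm 1 (max_real_subfield K) (q ^+ m * D%:R)).
  by apply: integral_prod => s _; exact: ((integral_morph (gal_repr s) _).1 iq).
have -> : galNorm 1 (max_real_subfield K) (q ^+ m * D%:R) = (r ^+ m * D%:R ^+ #|G|)%:A.
  rewrite galNormM galNormX nq [RHS](rmorphM (in_alg K)) !(rmorphXn (in_alg K)); congr (_ * _).
  rewrite /galNorm (eq_bigr (fun=> D%:R)) ?prodr_const ?(rmorph_nat (in_alg K)) // => s _.
  exact: rmorph_nat.
by move=> /(integral_morph (in_alg K))/integral_rat.
Qed.

(** Exchanging [a] and [b] inverts the cross ratio, so the bound on denominators also bounds the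
    numerator. *)
Lemma galNorm_bounds (q : K) (r : rat) (N : nat) (a b c d : R[i]) : (0 < N)%N ->
  a ^+ N = 1 -> b ^+ N = 1 -> c ^+ N = 1 -> d ^+ N = 1 ->
  c != a -> d != b -> c != b -> d != a ->
  emb q = (c - a) * (d - b) / ((c - b) * (d - a)) ->
  galNorm 1 (max_real_subfield K) q = r%:A ->
  (`|numq r| <= 4 ^ n)%N /\ (`|denq r| <= 4 ^ n)%N.
Proof.
move=> N0 aN bN cN dN ca db cb da qE nq.
have q0 : q != 0.
  rewrite -(fmorph_eq0 emb) qE.
  by rewrite !mulf_neq0 ?invr_eq0 ?mulf_neq0 // ?subr_eq0.
have r0 : r != 0.
  have : galNorm 1 (max_real_subfield K) q != 0 by rewrite galNorm_eq0.
  by rewrite nq; apply: contraNneq => ->; rewrite scale0r.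
have num0 : numq r != 0 by rewrite numq_eq0.
have cop : coprimez (numq r) (denq r) by rewrite coprimezE coprime_num_den.
split.
  have [m [D [m0 D4]]] := cross_ratio_root1_integral N0 bN aN cN dN ca db.
  rewrite [X in X ^+ m](_ : _ = emb q^-1); last by rewrite fmorphV qE invf_div.
  rewrite -rmorphXn -(rmorph_nat emb) -rmorphM => /(integral_morph emb).
  apply: (@galNorm_denominator _ r^-1 (denq r) (numq r)) => //; last by rewrite coprimez_sym.
    by rewrite galNormV nq -(rmorphV (in_alg K)) ?unitfE.
  by rewrite -{1}(divq_num_den r) invf_div.
have [m [D [m0 D4]]] := cross_ratio_root1_integral N0 aN bN cN dN cb da.
rewrite -qE -rmorphXn -(rmorph_nat emb) -rmorphM => /(integral_morph emb).
by apply: (@galNorm_denominator _ r (numq r) (denq r)) => //; rewrite ?divq_num_den ?denq_neq0.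
Qed.

Lemma max_real_norm_rat (q : K) : q \in max_real_subfield K ->
  exists r : rat, galNorm 1 (max_real_subfield K) q = r%:A.
Proof. by move=> /(mem_galNorm max_real_galois)/vlineP. Qed.

End CyclotomicField.

(** * Model sets are locally finite *)

Section LocalFiniteness.
Import numFieldNormedType.Exports.
Variables (R : realType) (n : nat) (n_ge3 : (3 <= n)%N) (K : cyclotomic_field R n).
Local Notation z := (cf_gen K).
Local Notation emb := (cf_emb K).
Local Notation G := 'Gal({:K} / 1)%g.
Local Notation Tr := (galTrace 1 {:K}).

Lemma window_bounded (W : set {ptws 'I_(star_dim n) -> (R * R)%type}) : window W ->
  exists B : R, forall w i, W w -> `|(w i).1| <= B /\ `|(w i).2| <= B.
Proof.
move=> [_ sW cW].
have bnd i : exists B : R, forall w, W w -> `|w i| <= B.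
  have : compact ((@proj 'I_(star_dim n) (fun=> (R * R)%type) i) @` closure W°).
    apply: continuous_compact => //; apply: continuous_subspaceT; exact: proj_continuous.
  move=> /compact_bounded[M [_ hM]]; exists (M + 1) => w Ww.
  have := hM (M + 1); rewrite ltrDl ltr01 => /(_ isT) hM1.
  by apply: (hM1 (w i)); exists w => //; apply: sW.
have [B hB] := choice bnd.
exists (\sum_i `|B i|) => w i Ww.
have : `|w i| <= \sum_i `|B i|.
  apply: (le_trans (hB i w Ww)); apply: (le_trans (ler_norm _)).
  by rewrite (bigD1 i) //= lerDl sumr_ge0.
by rewrite prod_normE ge_max => /andP.
Qed.

Lemma normc_le_Re_Im (w : R[i]) (B : R) : `|complex.Re w| <= B -> `|complex.Im w| <= B ->
  `|w| <= (B + B)%:C%C.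
Proof.
case: w => a b /= ha hb; rewrite normc_def lecR /=.
have B0 : 0 <= B by apply: le_trans ha.
rewrite -[leRHS]ger0_norm ?addr_ge0 // -sqrtr_sqr ler_sqrt ?sqr_ge0 //.
have h (x : R) : `|x| <= B -> x ^+ 2 <= B ^+ 2.
  by move=> hx; rewrite -real_normK ?num_real // ler_pXn2r ?nnegrE.
have := h a ha; have := h b hb; nra.
Qed.

Lemma gal_base (s : gal_of {:K}) (c y : K) : s \in G -> c \in 1%VS -> s (c * y) = c * s y.
Proof. by move=> sG c1; rewrite rmorphM /= (fixed_gal (sub1v _) sG c1). Qed.

(** The powers of [z] span [K] over the rationals, so for nonzero [w] the trace of [w * w^-1] would
    vanish; but the trace of 1 is the order of the Galois group. *)
Lemma trace_form_nondegenerate (w : K) : (forall j : 'I_n, Tr (w * z ^+ j) = 0) -> w = 0.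
Proof.
move=> h; apply/eqP; apply: contraT => w0.
have hj j : Tr (w * z ^+ j) = 0.
  rewrite -(prim_expr_mod (cf_gen_prim n_ge3 K)).
  by apply: (h (Ordinal (ltn_pmod j _))); lia.
have : Tr (w * w^-1) = 0.
  have [p p1 ->] := cf_polyP w^-1.
  rewrite horner_coef mulr_sumr raddf_sum big1 // => i _.
  rewrite /galTrace mulrCA; transitivity (p`_i * Tr (w * z ^+ i)); last by rewrite hj mulr0.
  rewrite /galTrace mulr_sumr; apply: eq_bigr => s sG.
  by apply: gal_base => //; exact: (polyOverP p1).
rewrite divff // /galTrace (eq_bigr (fun=> 1)); last by move=> s _; exact: rmorph1.
rewrite sumr_const => /eqP; rewrite -(fmorph_eq0 emb) rmorph_nat pnatr_eq0.
by rewrite eqn0Ngt cardG_gt0.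
Qed.

Lemma Zadj_integral (x : K) : Zadj z x -> integralZ x.
Proof.
move=> [p ->]; apply: integral_horner.
  by move=> c /(nthP 0)[i _ <-]; rewrite coef_map /=; apply: integral_id.
have n0 : (0 < n)%N by lia.
exact: (integral_root1 n0 (prim_expr_order (cf_gen_prim n_ge3 K))).
Qed.

(** By nondegeneracy [x] is determined by the traces of [x * z ^+ j] for [j < n], which are integers
    of absolute value at most [b]. *)
Lemma finite_bounded_conjugates (B : R) :
  finite_set [set x : K | Zadj z x /\ forall s, s \in G -> `|emb (s x)| <= B%:C%C].
Proof.
set S := [set x | _].
pose b : nat := Num.Def.archi_bound (#|G|%:R * `|B|).
have intTr x (j : 'I_n) : S x -> exists k : int, Tr (x * z ^+ j) = k%:~R /\ (`|k| <= b)%N.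
  move=> [Zx hx].
  have n0 : (0 < n)%N by lia.
  have ix : integralZ (x * z ^+ j).
    apply: integral_mul; first exact: Zadj_integral.
    apply: integralX; exact: (integral_root1 n0 (prim_expr_order (cf_gen_prim n_ge3 K))).
  have iT : integralZ (Tr (x * z ^+ j)).
    by apply: integral_sum => s _; exact: ((integral_morph (gal_repr s) _).1 ix).
  have [r er] : exists r : rat, Tr (x * z ^+ j) = r%:A.
    by have /vlineP := mem_galTrace (cf_galois K) (memvf (x * z ^+ j)).
  have /intrP[k ek] : r \is a Num.int.
    by move: iT; rewrite er => /(integral_morph (in_alg K))/integral_rat.
  have eT : Tr (x * z ^+ j) = k%:~R by rewrite er ek [LHS](rmorph_int (in_alg K)).
  exists k; split => //.
  have bB : #|G|%:R * `|B| < b%:R :> R by apply: archi_boundP; rewrite mulr_ge0.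
  have : `|emb (Tr (x * z ^+ j))| <= (#|G|%:R * `|B|)%:C%C.
    rewrite /galTrace rmorph_sum; apply: (le_trans (ler_norm_sum _ _ _)).
    rewrite rmorphM rmorph_nat mulr_natl -sumr_const; apply: ler_sum => s sG.
    rewrite !rmorphM !rmorphXn /= normrM normrX.
    have -> : `|emb (s z)| = 1.
      have : `|emb (s z)| ^+ n = 1.
        by rewrite -normrX -!rmorphXn /= (prim_expr_order (cf_gen_prim n_ge3 K)) !rmorph1 normr1.
      by move=> /eqP; rewrite pexpr_eq1 // => /eqP.
    rewrite expr1n mulr1; apply: (le_trans (hx s sG)); rewrite lecR; exact: ler_norm.
  rewrite eT rmorph_int => h.
  have h2 : `|k%:~R : R[i]| = (`|k|%N%:R : R)%:C%C.
    by rewrite rmorph_nat natr_absz intr_norm.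
  move: h; rewrite h2 lecR => h.
  by rewrite ltnW // -(ltr_nat R) (le_lt_trans h).
have [g hg] : exists g : K -> 'I_n -> int, forall x (j : 'I_n), S x -> Tr (x * z ^+ j) = (g x j)%:~R /\ (`|g x j| <= b)%N.
  have /choice[g hg] : forall x : K * 'I_n, exists k : int, S x.1 -> Tr (x.1 * z ^+ x.2) = k%:~R /\ (`|k| <= b)%N.
    move=> [x j] /=; have [Sx|nS] := pselect (S x); last by exists 0.
    by have [k hk] := intTr x j Sx; exists k.
  by exists (fun x j => g (x, j)) => x j Sx; apply: (hg (x, j)).
pose f x : {ffun 'I_n -> 'I_(b + b).+1} := [ffun j => inord (absz (g x j + b%:Z))].
have f_inj x y : S x -> S y -> f x = f y -> x = y.
  move=> Sx Sy exy; apply/eqP; rewrite -subr_eq0; apply/eqP.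
  apply: trace_form_nondegenerate => j; rewrite mulrBl raddfB /=.
  have [-> b1] := hg x j Sx; have [-> b2] := hg y j Sy.
  suff -> : g x j = g y j by rewrite subrr.
  move: exy => /ffunP/(_ j); rewrite !ffunE => /(congr1 val) /=.
  rewrite !inordK; lia.
pose h phi := xget 0 [set x | S x /\ f x = phi].
apply: (@sub_finite_set _ _ (h @` [set: {ffun 'I_n -> 'I_(b + b).+1}])).
  move=> x Sx; exists (f x) => //; rewrite /h.
  case: xgetP => [y _ [Sy e]|/(_ x)]; first exact: f_inj.
  by case.
exact/finite_image/finite_finset.
Qed.

(** Every automorphism is trivial, conjugation or, up to conjugation, a component of the star map;
    so the bound on [C] and the bounded window control all conjugates. *)
Lemma model_set_locally_finite (L C : set R[i]) (B : R) : cyclotomic_model_set K L ->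
  C `<=` L -> (forall w, C w -> `|w| <= B%:C%C) -> finite_set C.
Proof.
move=> [s [W [t [[_ sE] winW ->]]]] CL CB.
have [BW hW] := window_bounded winW.
have [T hT] : exists T : R, `|t| = T%:C%C by exists (Num.sqrt (complex.Re t ^+ 2 + complex.Im t ^+ 2)); rewrite normc_def.
pose B' := Num.max (B + T) (BW + BW).
apply: (@sub_finite_set _ _ ((fun x => t + emb x) @` [set x : K | Zadj z x /\ forall s, s \in G -> `|emb (s x)| <= B'%:C%C])); last first.
  exact/finite_image/finite_bounded_conjugates.
move=> w Cw; have [x [Zx Wx] ew] := CL w Cw; exists x => //; split => // r rG.
have hx : `|emb x| <= B'%:C%C.
  have -> : emb x = w - t by rewrite -ew addrAC subrr add0r.
  apply: (le_trans (ler_normB _ _)); rewrite hT; apply: (@le_trans _ _ (B + T)%:C%C).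
    by rewrite rmorphD lerD2r CB.
  by rewrite lecR le_max lexx.
have hi i : `|emb (s i x)| <= B'%:C%C.
  have [h1 h2] := hW _ i Wx.
  apply: (le_trans (normc_le_Re_Im h1 h2)).
  by rewrite lecR le_max lexx orbT.
have [->|r1] := eqVneq r 1%g; first by rewrite gal_id.
have [rc|rc] := pselect (conjugate_auts r 1%g).
  by rewrite rc gal_id norm_conjC.
have [|i [[ei|ei] _]] := sE r.
- by split => //; apply/eqP.
- by rewrite -ei.
- by have := hi i; rewrite ei norm_conjC.
Qed.

End LocalFiniteness.

(** * X-rays and cross ratios *)

Section XrayImbalance.
Variable R : realType.
Local Notation Re := complex.Re.
Local Notation Im := complex.Im.

Lemma card_fset_count (I : choiceType) (A : {fset I}) (Q : pred I) :
  #|` [fset w in A | Q w]%fset| = count Q A.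
Proof.
rewrite -size_filter; apply: perm_size; apply: uniq_perm; rewrite ?filter_uniq ?fset_uniq //.
by move=> w; rewrite !inE mem_filter andbC.
Qed.

Lemma line_of_level (u : R[i]) (x : R) : u != 0 ->
  exists2 l, lines u l & forall w, l w <-> detc u w = x.
Proof.
move=> u0; have d0 := lt0r_neq0 (dotc_gt0 u0).
pose w0 : R[i] := (x / dotc u u)%:C%C * (- Im u +i* Re u)%C.
have w0x : detc u w0 = x.
  by move: d0; rewrite /w0 /dotc /detc; case: (u) => a b /= d0; field.
exists [set w0 + k%:C%C * u | k in @setT R]; first by exists w0.
move=> w; split=> [[k _ <-]|e]; first by rewrite detcDr detcZr addr0.
have /(detc_eq0P u0) h : detc u (w - w0) = 0 by rewrite detcBr e w0x subrr.
by exists (dotc u (w - w0) / dotc u u) => //; rewrite -h addrC subrK.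
Qed.

Lemma Xray_count (F : set R[i]) (u : R[i]) (x : R) l : finite_set F ->
  (forall w, l w <-> detc u w = x) ->
  Xray F l = #|` [fset w in fset_set F | detc u w == x]%fset|.
Proof.
move=> fF hl; rewrite /Xray; congr (size (enum_fset _)); apply/fsetP => w.
rewrite in_fset_set ?inE; last exact: finite_setIl.
rewrite in_fset_set //; apply/idP/idP => [/set_mem[Fw /hl ->]|/andP[/set_mem Fw /eqP e]].
  by rewrite eqxx andbT; apply/mem_set.
by apply/mem_set; split => //; apply/hl.
Qed.

(** Points common to [F] and [F'] contribute equally to both X-rays and cancel, which leaves the
    symmetric difference. *)
Lemma same_Xray_balanced (F F' : set R[i]) (A := fset_set F) (B := fset_set F')
    (D := ((A `\` B) `|` (B `\` A))%fset) (u : R[i]) :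
  finite_set F -> finite_set F' -> u != 0 -> same_Xray u F F' ->
  balanced (fun p : D => val p) (fun p : D => val p \in A) u.
Proof.
move=> fF fF' u0 same x.
have [l lu hl] := line_of_level x u0.
have := same l lu; rewrite (Xray_count fF hl) (Xray_count fF' hl) -/A -/B.
have cardD (Q : pred R[i]) : #|[pred p : D | Q (val p)]| = #|` [fset w in D | Q w]%fset|.
  by rewrite card_fset_count -sum1_card -sum1_count big_seq_fsetE.
rewrite (cardD (fun w => (w \in A) && (detc u w == x))) (cardD (fun w => (w \notin A) && (detc u w == x))).
set A' := [fset w in A | _]%fset; set B' := [fset w in B | _]%fset => e.
have -> : [fset w in D | (w \in A) && (detc u w == x)]%fset = (A' `\` B')%fset.
  apply/fsetP => w; rewrite !inE.
  by case: (w \in A) (w \in B) (detc u w == x) => [] [] [].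
have -> : [fset w in D | (w \notin A) && (detc u w == x)]%fset = (B' `\` A')%fset.
  apply/fsetP => w; rewrite !inE.
  by case: (w \in A) (w \in B) (detc u w == x) => [] [] [].
have h1 := cardfsID B' A'; have h2 := cardfsID A' B'; rewrite fsetIC in h2.
by apply: (@addnI #|` (A' `&` B')%fset|); rewrite h1 h2.
Qed.

End XrayImbalance.

(** * Cross ratios as quotients of determinants *)

Section CrossRatio.
Variable R : realType.
Local Notation Re := complex.Re.
Local Notation Im := complex.Im.

(** A difference of slopes is [detc u v / (Re u * Re v)], and the real parts cancel. At most one of
    the directions is vertical; each such case is computed apart. *)
Lemma slope_cross_ratio (u1 u2 u3 u4 : R[i]) :
  detc u1 u2 != 0 -> detc u1 u3 != 0 -> detc u1 u4 != 0 ->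
  detc u2 u3 != 0 -> detc u2 u4 != 0 -> detc u3 u4 != 0 ->
  cross_ratio (slope u1) (slope u2) (slope u3) (slope u4) =
  detc u1 u3 * detc u2 u4 / (detc u2 u3 * detc u1 u4).
Proof.
have slopeB (u v : R[i]) : Re u != 0 -> Re v != 0 ->
    Im v / Re v - Im u / Re u = detc u v / (Re u * Re v).
  by move=> u0 v0; rewrite /detc; field; rewrite ?u0 ?v0.
have vert (u v : R[i]) : detc u v != 0 -> Re u = 0 ->
    [/\ Re v != 0, Im u != 0 & detc u v = - Im u * Re v].
  rewrite /detc => d u0; move: d; rewrite u0 mul0r sub0r oppr_eq0 mulf_eq0 negb_or mulNr.
  by case/andP.
have vert' (u v : R[i]) : detc u v != 0 -> Re v = 0 ->
    [/\ Re u != 0, Im v != 0 & detc u v = Im v * Re u].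
  rewrite /detc => d v0; move: d; rewrite v0 mulr0 subr0 mulf_eq0 negb_or mulrC.
  by case/andP.
move=> d12 d13 d14 d23 d24 d34; rewrite /slope.
have [z1|n1] := eqVneq (Re u1) 0.
  have [n2 m _] := vert _ _ d12 z1; have [n3 _ e13] := vert _ _ d13 z1; have [n4 _ e14] := vert _ _ d14 z1.
  rewrite (negbTE n2) (negbTE n3) (negbTE n4) /= !slopeB // e13 e14.
  by move: (detc _ _) (detc _ _) d23 d24 => x y x0 y0; field; rewrite ?x0 ?y0 ?m ?n2 ?n3 ?n4.
have [z2|n2] := eqVneq (Re u2) 0.
  have [n3 m e23] := vert _ _ d23 z2; have [n4 _ e24] := vert _ _ d24 z2.
  rewrite (negbTE n3) (negbTE n4) /= !slopeB // e23 e24.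
  by move: (detc _ _) (detc _ _) d13 d14 => x y x0 y0; field; rewrite ?x0 ?y0 ?m ?n1 ?n3 ?n4.
have [z3|n3] := eqVneq (Re u3) 0.
  have [n4 m _] := vert _ _ d34 z3; have [_ _ e13] := vert' _ _ d13 z3; have [_ _ e23] := vert' _ _ d23 z3.
  rewrite (negbTE n4) /= !slopeB // e13 e23.
  by move: (detc _ _) (detc _ _) d24 d14 => x y x0 y0; field; rewrite ?x0 ?y0 ?m ?n1 ?n2 ?n4.
have [z4|n4] := eqVneq (Re u4) 0.
  have [_ m e14] := vert' _ _ d14 z4; have [_ _ e24] := vert' _ _ d24 z4.
  rewrite /= !slopeB // e14 e24.
  by move: (detc _ _) (detc _ _) d13 d23 => x y x0 y0; field; rewrite ?x0 ?y0 ?m ?n1 ?n2 ?n3.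
rewrite /= !slopeB //.
move: (detc _ _) (detc _ _) (detc _ _) (detc _ _) d13 d24 d23 d14 => x y z t x0 y0 z0 t0.
by field; rewrite ?x0 ?y0 ?z0 ?t0 ?n1 ?n2 ?n3 ?n4.
Qed.

(** The determinant [detc] up to the factor [2i], in a form suited to relations [m = w * m^*]. *)
Definition skew (x y : R[i]) : R[i] := x^* * y - x * y^*.

Lemma skew_detc (u v : R[i]) : skew u v = (2 * 'i)%C * (detc u v)%:C%C.
Proof. by case: u v => a b [c d]; apply/eqP; rewrite /skew /detc eq_complex /=; apply/andP; split; apply/eqP; ring. Qed.

Lemma skew_linear (X Y u v : R[i]) :
  skew ((Re u)%:C%C * X + (Im u)%:C%C * Y) ((Re v)%:C%C * X + (Im v)%:C%C * Y) = skew X Y * (detc u v)%:C%C.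
Proof.
case: u v X Y => a b [c d] [e f] [g h]; apply/eqP; rewrite /skew /detc eq_complex /=.
by apply/andP; split; apply/eqP; ring.
Qed.

(** In a cross ratio of such values the conjugates cancel, and only differences of the reflection
    factors remain. *)
Lemma skew_reflected (x y v w : R[i]) : x = v * x^* -> y = w * y^* ->
  skew x y = x^* * y^* * (w - v).
Proof. by rewrite /skew; move: (x^*) (y^*) => x' y' -> ->; ring. Qed.

Lemma detc_nonparallel (u v : R[i]) : u != 0 -> v != 0 -> ~ parallel u v -> detc u v != 0.
Proof.
move=> u0 v0 np; apply/eqP => e; apply: np.
have e' : detc v u = 0 by rewrite -[RHS]oppr0 -e /detc; ring.
exists (dotc v u / dotc v v); split; last exact: detc_eq0P.
by apply: contraNneq u0 => k0; rewrite (detc_eq0P v0 e') k0 mul0r.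
Qed.

End CrossRatio.

(** * From equal X-rays to roots of unity *)

Section Tomography.
Variable R : realType.
Local Notation Re := complex.Re.
Local Notation Im := complex.Im.

(** The moment map is given by its values [X] at 1 and [Y] at ['i]. Two nonparallel directions have
    different [w], which forces [N > 2] and makes the map invertible. *)
Lemma direction_linear_roots (L F F' : set R[i]) (u1 u2 : R[i]) :
  finite_set F -> finite_set F' -> F = convex_hull F `&` L -> F' = convex_hull F' `&` L -> F <> F' ->
  u1 != 0 -> u2 != 0 -> detc u1 u2 != 0 -> same_Xray u1 F F' -> same_Xray u2 F F' ->
  exists N X Y, [/\ (0 < N)%N, skew X Y != 0 &
    forall u, u != 0 -> same_Xray u F F' -> exists w, let m := (Re u)%:C%C * X + (Im u)%:C%C * Y in
      [/\ w ^+ N = 1, m != 0 & m = w * m^*]].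
Proof.
move=> fF fF' hF hF' neF u10 u20 d12 s1 s2.
pose A := fset_set F; pose B := fset_set F'.
pose D := ((A `\` B) `|` (B `\` A))%fset.
pose pt (p : D) : R[i] := val p; pose col (p : D) := val p \in A.
have bal u : u != 0 -> same_Xray u F F' -> balanced pt col u by exact: same_Xray_balanced.
have inA w : (w \in A) = (w \in F) by rewrite in_fset_set.
have inB w : (w \in B) = (w \in F') by rewrite in_fset_set.
have inD (p : D) : (val p \in B) = ~~ col p.
  by have := valP p; rewrite !inE /col; case: (_ \in A) (_ \in B) => [] [].
have [p0] : exists p0 : D, True.
  apply: contrapT => nD; apply: neF; apply/seteqP; split=> w Fw; apply: contrapT => nF.
    have wD : w \in D by rewrite !inE inA inB [w \in F]mem_set // [w \in F']memNset.
    by apply: nD; exists [` wD]%fset.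
  have wD : w \in D by rewrite !inE inA inB [w \in F]memNset // [w \in F']mem_set.
  by apply: nD; exists [` wD]%fset.
move=> _.
(* Convexity enters here: a point of one set outside the other lies in [L], hence outside the convex
   hull of the other. *)
have dir p : exists v, forall q, col p != col q -> 0 < dotc (pt p - pt q) v.
  case cp : (col p).
    have pF : F (val p) by apply/set_mem; rewrite -inA.
    have pF' : ~ F' (val p) by move=> /mem_set; rewrite -inB inD cp.
    have [||v hv] := @separating_direction _ F' (enum_fset B) (val p).
    - by move=> q; rewrite inB => /set_mem.
    - move=> hp; apply: pF'; rewrite hF'; split => //.
      by move: pF; rewrite hF => -[].
    by exists v => q cq; apply: hv; rewrite inD; case: (col q) cq.
  have pF' : F' (val p) by apply/set_mem; rewrite -inB inD cp.
  have pF : ~ F (val p) by move=> /mem_set; rewrite -inA -/(col p) cp.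
  have [||v hv] := @separating_direction _ F (enum_fset A) (val p).
  - by move=> q; rewrite inA => /set_mem.
  - move=> hp; apply: pF; rewrite hF; split => //.
    by move: pF'; rewrite hF' => -[].
  by exists v => q cq; apply: hv; move: cq; rewrite /col; case: (_ \in A).
have /choice[arg harg] : forall p : D, exists t : R, 0 <= t < 2 * pi /\
    forall q, col p != col q -> 0 < dotc (pt p - pt q) (cis t).
  move=> p; have [v hv] := dir p.
  have [q cq _] := balanced_linked (bal _ u10 s1) p.
  have v0 : v != 0.
    apply: contraTneq (hv q _) => [->|]; last by rewrite eq_sym.
    by rewrite /dotc /= !mulr0 addr0 ltxx.
  have [r r0 [t t0 [e1 e2]]] := polarP v0; exists t; split => // q' cq'.
  have := hv q' cq'; rewrite /dotc e1 e2 /cis /= => h.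
  rewrite -(pmulr_rgt0 _ r0); apply: lt_le_trans h _.
  by rewrite le_eqVlt; apply/orP; left; apply/eqP; ring.
have arg_itv p := (harg p).1; have arg_sep p := (harg p).2.
pose W := weight col arg p0.
pose N := changes (cyc_col col arg p0) #|{: D}|.
have refl u : u != 0 -> same_Xray u F F' -> (0 < N)%N /\ exists2 w, w ^+ N = 1 &
    forall p q, col p != col q -> detc u (pt p) = detc u (pt q) -> W p * W q = w.
  move=> u0 su.
  have [k [K [d [[NE hw _ _ _] _]]]] := reflection_weights arg_itv arg_sep p0 u0 (balanced_linked (bal _ u0 su)).
  have N0 : (0 < N)%N by rewrite /N NE.
  split => //; exists (zeta R N ^+ (2 * k).+1) => //.
  by rewrite -exprM mulnC exprM (prim_expr_order (zeta_prim_root R N0)) expr1n.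
have [N0 [w1 w1N hw1]] := refl _ u10 s1; have [_ [w2 w2N hw2]] := refl _ u20 s2.
have w12 : w1 != w2.
  exact: (link_weight_neq arg_itv arg_sep u10 u20 (balanced_linked (bal _ u10 s1)) (balanced_linked (bal _ u20 s2)) d12 hw1 hw2).
have N2 : (2 < N)%N.
  have [k [K [d [[NE hw _ _ _] _]]]] := reflection_weights arg_itv arg_sep p0 u10 (balanced_linked (bal _ u10 s1)).
  have [k' [K' [d' [[NE' hw' _ _ _] _]]]] := reflection_weights arg_itv arg_sep p0 u20 (balanced_linked (bal _ u20 s2)).
  have := link_weight_neq arg_itv arg_sep u10 u20 (balanced_linked (bal _ u10 s1)) (balanced_linked (bal _ u20 s2)) d12 hw hw'.
  rewrite ltnNge; apply: contra => leN.
  (* For [N = 2] all odd powers of [zeta] coincide, although the two directions have different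
     ones. *)
  have N_2 : N = 2%N by apply/eqP; rewrite eqn_leq leN /N NE.
  by rewrite -/N N_2 !exprS !exprM -N_2 (prim_expr_order (zeta_prim_root R N0)) !expr1n.
exists N, (moment pt col arg p0 1), (moment pt col arg p0 'i%C).
have main u : u != 0 -> same_Xray u F F' -> forall w,
    (forall p q, col p != col q -> detc u (pt p) = detc u (pt q) -> W p * W q = w) ->
    let m := moment pt col arg p0 u in m != 0 /\ m = w * m^*.
  move=> u0 su w hw; split.
    exact: (moment_neq0 arg_itv arg_sep u0 (balanced_linked (bal _ u0 su)) N2).
  exact: moment_reflect (bal _ u0 su) hw.
split => //.
  have [m1 r1] := main _ u10 s1 _ hw1; have [m2 r2] := main _ u20 s2 _ hw2.
  have := skew_reflected r1 r2; rewrite moment_linear (moment_linear pt col arg p0 u2) skew_linear.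
  rewrite -!moment_linear => e; apply: contraNneq w12 => sk0; move: e; rewrite sk0 mul0r => /esym/eqP.
  by rewrite !mulf_eq0 !conjC_eq0 (negbTE m1) (negbTE m2) /= subr_eq0 eq_sym.
move=> u u0 su; have [_ [w wN hw]] := refl _ u0 su; exists w; rewrite -moment_linear.
by have [h1 h2] := main _ u0 su _ hw.
Qed.

End Tomography.

(** * The cross ratio in the maximal real subfield and the finite set of norms *)

Lemma finite_bounded_rationals (B : nat) : finite_set [set r : rat | (`|numq r| <= B)%N /\ (`|denq r| <= B)%N].
Proof.
pose f (x : bool * 'I_B.+1 * 'I_B.+1) : rat := (-1) ^+ x.1.1 * (x.1.2%:R / x.2%:R).
apply: (@sub_finite_set _ _ (f @` [set: bool * 'I_B.+1 * 'I_B.+1])); last exact/finite_image/finite_finset.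
move=> r [h1 h2]; exists ((numq r < 0, inord `|numq r|%N), inord `|denq r|%N) => //.
rewrite /f /= !inordK ?ltnS // -[RHS]divq_num_den mulrA; congr (_ / _).
  by rewrite [in RHS](intEsign (numq r)) rmorphM rmorph_sign.
by rewrite pmulrn absz_denq.
Qed.

Section Directions.
Variables (R : realType) (n : nat) (n_ge3 : (3 <= n)%N) (K : cyclotomic_field R n).
Local Notation emb := (cf_emb K).

Lemma set_direction_emb (u : R[i]) : set_direction (Zadj (zeta R n)) u ->
  u != 0 /\ exists (x : K) (k : R), k != 0 /\ emb x = k%:C%C * u.
Proof.
move=> [u1 [x [y [[p px] [q qy] _ [k [k0 e]]]]]].
split; first by rewrite -normr_eq0 u1 oner_eq0.
have Zemb (p' : {poly int}) : emb (map_poly intr p').[cf_gen K] = (map_poly intr p').[zeta R n].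
  rewrite -horner_map (cf_emb_gen K) -map_poly_comp; congr _.[_].
  by apply: eq_map_poly => i /=; rewrite rmorph_int.
exists ((map_poly intr p).[cf_gen K] - (map_poly intr q).[cf_gen K]), k; split => //.
by rewrite rmorphB !Zemb -px -qy.
Qed.

(* The factors k_i relating the directions to elements of K cancel. *)
Lemma cross_ratio_in_field (u1 u2 u3 u4 : R[i]) :
  (forall u, u \in [:: u1; u2; u3; u4] -> set_direction (Zadj (zeta R n)) u) ->
  detc u2 u3 != 0 -> detc u1 u4 != 0 ->
  exists2 q : K, q \in max_real_subfield K &
    emb q = (detc u1 u3 * detc u2 u4 / (detc u2 u3 * detc u1 u4))%:C%C.
Proof.
move=> dir d23 d14.
have ex u : u \in [:: u1; u2; u3; u4] -> exists x x' : K, exists2 k : R, k != 0 & emb x = k%:C%C * u /\ emb x' = (k%:C%C * u)^*.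
  move=> /dir/set_direction_emb[_ [x [k [k0 e]]]]; have [x' e'] := cf_conj x.
  by exists x, x', k; rewrite // e' e.
have [|x1 [y1 [k1 n1 [e1 f1]]]] := ex u1; first by rewrite !inE eqxx.
have [|x2 [y2 [k2 n2 [e2 f2]]]] := ex u2; first by rewrite !inE eqxx ?orbT.
have [|x3 [y3 [k3 n3 [e3 f3]]]] := ex u3; first by rewrite !inE eqxx ?orbT.
have [|x4 [y4 [k4 n4 [e4 f4]]]] := ex u4; first by rewrite !inE eqxx ?orbT.
have key (x y x' y' : K) (k k' : R) (u v : R[i]) : emb x = k%:C%C * u -> emb y = (k%:C%C * u)^* ->
    emb x' = k'%:C%C * v -> emb y' = (k'%:C%C * v)^* ->
    emb (y * x' - x * y') = (2 * 'i)%C * (k * k' * detc u v)%:C%C.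
  move=> ex1 ey1 ex2 ey2; rewrite rmorphB !(rmorphM emb) ex1 ey1 ex2 ey2 -/(skew _ _) skew_detc.
  have -> // : detc (k%:C%C * u) (k'%:C%C * v) = k * k' * detc u v.
  by case: (u) (v) => a b [c d]; rewrite /detc /=; ring.
(* Each [y] is the conjugate of its [x], so every factor is a real multiple of [2i] and the quotient
   is real. *)
pose q := (y1 * x3 - x1 * y3) * (y2 * x4 - x2 * y4) / ((y2 * x3 - x2 * y3) * (y1 * x4 - x1 * y4)).
have qE : emb q = (detc u1 u3 * detc u2 u4 / (detc u2 u3 * detc u1 u4))%:C%C.
  rewrite fmorph_div !(rmorphM emb) (key _ _ _ _ _ _ _ _ e1 f1 e3 f3) (key _ _ _ _ _ _ _ _ e2 f2 e4 f4)
    (key _ _ _ _ _ _ _ _ e2 f2 e3 f3) (key _ _ _ _ _ _ _ _ e1 f1 e4 f4).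
  have i0 : (2 * 'i)%C != 0 :> R[i] by rewrite mulf_eq0 pnatr_eq0 /= eq_complex /= oner_eq0 andbF.
  rewrite fmorph_div !rmorphM /=.
  have h23 : (detc u2 u3)%:C%C != 0 :> R[i] by rewrite fmorph_eq0.
  have h14 : (detc u1 u4)%:C%C != 0 :> R[i] by rewrite fmorph_eq0.
  have g (k : R) : k != 0 -> k%:C%C != 0 :> R[i] by rewrite fmorph_eq0.
  move: (g _ n1) (g _ n2) (g _ n3) (g _ n4) i0 h23 h14.
  move: (k1%:C)%C (k2%:C)%C (k3%:C)%C (k4%:C)%C (2 * 'i)%C => a b c d e a0 b0 c0 d0 e0 h23 h14.
  by field; rewrite a0 b0 c0 d0 e0 h23 h14.
exists q => //; apply: (real_max_real n_ge3).
by rewrite qE CrealE; apply/eqP; exact: conjc_real.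
Qed.

End Directions.

Theorem theorem4p33 (R : realType) (n : nat) (hn : (3 <= n)%N) :
  exists N : {fset rat},
    forall (K : cyclotomic_field R n) (L : set R[i]) (U : {fset R[i]}),
      cyclotomic_model_set K L ->
      #|` U| = 4%N ->
      (forall u, u \in U -> set_direction (Zadj (zeta R n)) u) ->
      (forall u v, u \in U -> v \in U -> u <> v -> ~ parallel u v) ->
      (forall r : rat, real_norm K (slopes_cross_ratio U) r -> r \notin N) ->
      determined_by_Xrays (convex_subset L) [set` U].
Proof.
have finN := finite_bounded_rationals (4 ^ n).
(* The bound [4 ^ n] comes from the norm estimate and depends neither on [L] nor on [U]. *)
exists (fset_set [set r : rat | (`|numq r| <= 4 ^ n)%N /\ (`|denq r| <= 4 ^ n)%N]).
move=> K L U modL cardU dirU npU normU F F' [[M bF] FL hF] [[M' bF'] FL' hF'] same.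
apply: contrapT => neF.
have fF := model_set_locally_finite hn modL FL bF.
have fF' := model_set_locally_finite hn modL FL' bF'.
pose s := by_angle U.
have pU : perm_eq s U by rewrite perm_sort.
have size_s : size s = 4%N by rewrite (perm_size pU).
have uniq_s : uniq s by rewrite (perm_uniq pU) fset_uniq.
have inU i : (i < 4)%N -> s`_i \in U by move=> lt; rewrite -(perm_mem pU) mem_nth ?size_s.
have nzU u : u \in U -> u != 0 by move=> /dirU/(set_direction_emb K)[].
have det i j : (i < 4)%N -> (j < 4)%N -> i != j -> detc s`_i s`_j != 0.
  move=> li lj ne; apply: detc_nonparallel; rewrite ?nzU ?inU //.
  by apply: npU; rewrite ?inU //; apply/eqP; rewrite nth_uniq ?size_s.
have sX i : (i < 4)%N -> same_Xray s`_i F F' by move=> lt; apply: same; exact: inU.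
have nz i : (i < 4)%N -> s`_i != 0 by move=> lt; rewrite nzU ?inU.
have [N [X [Y [N0 sk0 lin]]]] := direction_linear_roots fF fF' hF hF' neF
  (nz 0%N isT) (nz 1%N isT) (det 0%N 1%N isT isT isT) (sX 0%N isT) (sX 1%N isT).
have crE := slope_cross_ratio (det 0%N 1%N isT isT isT) (det 0%N 2%N isT isT isT) (det 0%N 3%N isT isT isT)
  (det 1%N 2%N isT isT isT) (det 1%N 3%N isT isT isT) (det 2%N 3%N isT isT isT).
have [|q qM qE] := @cross_ratio_in_field _ _ hn K s`_0 s`_1 s`_2 s`_3 _ (det 1%N 2%N isT isT isT) (det 0%N 3%N isT isT isT).
  move=> u; rewrite !inE => /or4P[] /eqP ->; apply: dirU; exact: inU.
have [w wP] : exists w : nat -> R[i], forall i, (i < 4)%N -> let m := (complex.Re s`_i)%:C%C * X + (complex.Im s`_i)%:C%C * Y in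
    [/\ w i ^+ N = 1, m != 0 & m = w i * m^*].
  have /choice[w hw] : forall i : nat, exists w : R[i], (i < 4)%N -> let m := (complex.Re s`_i)%:C%C * X + (complex.Im s`_i)%:C%C * Y in
    [/\ w ^+ N = 1, m != 0 & m = w * m^*].
    move=> i; have [lt|_] := boolP (i < 4)%N; last by exists 0.
    by have [w hw] := lin _ (nz i lt) (sX i lt); exists w.
  by exists w.
pose m i := (complex.Re s`_i)%:C%C * X + (complex.Im s`_i)%:C%C * Y.
have skE i j : (i < 4)%N -> (j < 4)%N -> skew X Y * (detc s`_i s`_j)%:C%C = (m i)^* * (m j)^* * (w j - w i).
  by move=> li lj; have [_ _ ri] := wP i li; have [_ _ rj] := wP j lj; rewrite -skew_linear -skew_reflected.
have m0 i : (i < 4)%N -> (m i)^* != 0 by move=> lt; have [_ h _] := wP i lt; rewrite conjC_eq0.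
have wne i j : (i < 4)%N -> (j < 4)%N -> i != j -> w j != w i.
  move=> li lj ne; rewrite -subr_eq0; apply: contraNneq (det i j li lj ne) => e.
  have := skE i j li lj; rewrite e mulr0 => /eqP; rewrite mulf_eq0 (negbTE sk0) /=.
  by rewrite fmorph_eq0.
(* The skew form turns each determinant into [w j - w i] up to factors that cancel in the cross
   ratio. *)
have qw : cf_emb K q = (w 2%N - w 0%N) * (w 3%N - w 1%N) / ((w 2%N - w 1%N) * (w 3%N - w 0%N)).
  have detE i j : (i < 4)%N -> (j < 4)%N -> (detc s`_i s`_j)%:C%C = (m i)^* * (m j)^* * (w j - w i) / skew X Y.
    by move=> li lj; rewrite -skE // mulrAC divff // mul1r.
  rewrite qE fmorph_div !rmorphM /= !detE //.
  have := wne 1%N 2%N isT isT isT; have := wne 0%N 3%N isT isT isT; rewrite -!(subr_eq0 (w _)).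
  move: (m0 0%N isT) (m0 1%N isT) (m0 2%N isT) (m0 3%N isT) sk0.
  move: (_^*) (_^*) (_^*) (_^*) (skew X Y) (w 0%N) (w 1%N) (w 2%N) (w 3%N) => a b c d e x y z t a0 b0 c0 d0 e0 xt yz.
  by field; rewrite a0 b0 c0 d0 e0 xt yz.
have [r nr] := max_real_norm_rat hn qM.
have [w0 _ _] := wP 0%N isT; have [w1 _ _] := wP 1%N isT; have [w2 _ _] := wP 2%N isT; have [w3 _ _] := wP 3%N isT.
have [b1 b2] := galNorm_bounds hn N0 w0 w1 w2 w3 (wne 0%N 2%N isT isT isT) (wne 1%N 3%N isT isT isT)
  (wne 1%N 2%N isT isT isT) (wne 0%N 3%N isT isT isT) qw nr.
(* By the two bounds [r] lies in the set that the hypothesis on the norm excludes. *)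
have /negP[] : r \notin fset_set [set r : rat | (`|numq r| <= 4 ^ n)%N /\ (`|denq r| <= 4 ^ n)%N].
  by apply: normU; exists q; split => //; rewrite qE -crE.
by rewrite in_fset_set // mem_set.
Qed.
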